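(* Let $K$ be an infinite field, $n,r\ge 1$, and $S(B^+)=S(B^+,n,r)$. (1) The module $K_{(r,0,\dots,0)}$ is a direct summand of the socle of $S(B^+)$, independently of $\mathrm{char}\,K$. (2) Suppose $\mathrm{char}\,K=0$ and $n=2$. Then the socle of $S(B^+)$ is a direct sum of several copies of $K_{(r,0)}$. (3) Suppose $\mathrm{char}\,K=p>0$ and $n=2$. Then $K_\lambda$ is a direct summand of the socle of $S(B^+)$ if and only if $\lambda=(r,0)$ or $\lambda$ is a partition (with $\lambda_2\neq0$) satisfying $\lambda_1\ge p^{\lfloor\log_p\lambda_2\rfloor+1}-1$. (4) Suppose $n\ge3$ and $\mathrm{char}\,K=0$. Then all the composition factors of the socle of $S(B^+)$ are of the form $K_\lambda$ with $\lambda$ a partition such that $\lambda_n=0$. (5) Suppose $n\ge3$ and $\mathrm{char}\,K=p>0$. Then all the composition factors of the socle of $S(B^+)$ are of the form $K_\lambda$ with $\lambda$ a partition such that either $\lambda_n=0$ or $\lambda_{n-1}\ge p^{\lfloor\log_p\lambda_n\rfloor+1}-1$. (6) Suppose $n=3$, $\mathrm{char}\,K=p\ge3$, and $\lambda=(\lambda_1,\lambda_2,\lambda_3)\in\Lambda(3,r)$ with $\lambda_3\ne0$ satisfies $$\lambda_1\ge p^{\lfloor\log_p\lambda_3\rfloor+2}-1,\qquad \lambda_2=2p^{\lfloor\log_p\lambda_3\rfloor+1}-1.$$ Then the module $K_\lambda$ has non-zero multiplicity in the socle of $S(B^+)$.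
   Context: $\Lambda(n,r)$ is the set of $n$-tuples of non-negative integers with sum $r$; a partition is a weakly decreasing element of $\Lambda(n,r)$. The Borel-Schur algebra $S(B^+)=S(B^+,n,r)$ is the image of $KB^+$ in $\mathrm{End}_K((K^n)^{\otimes r})$ under the action $g(v_1\otimes\dots\otimes v_r)=gv_1\otimes\dots\otimes gv_r$, where $B^+$ is the group of upper triangular matrices in $\mathrm{GL}_n(K)$. For $i,j\in I(n,r)=\{1,\dots,n\}^r$ write $(i,j)\sim(h,k)$ if they are in the same orbit of $\Sigma_r$ acting by simultaneous place permutation, and $i\le j$ if $i_\rho\le j_\rho$ for all $\rho$. With $e_i=e_{i_1}\otimes\dots\otimes e_{i_r}$, $\xi_{i,j}$ is the endomorphism $e_k\mapsto\sum_{h:(h,k)\sim(i,j)}e_h$; the distinct $\xi_{i,j}$ with $i\le j$ form a basis of $S(B^+)$, and $\xi_\lambda:=\xi_{i,i}$ for $i$ of weight $\lambda$ (i.e. $\lambda_\nu=\#\{\rho:i_\rho=\nu\}$). For $\lambda\in\Lambda(n,r)$, $K_\lambda$ is the one-dimensional left $S(B^+)$-module $K$ on which $\xi_\lambda$ acts as the identity and all other basis elements $\xi_{i,j}$ ($i\le j$) act as zero; these are all the simple modules. The socle of $S(B^+)$ is the socle of $S(B^+)$ as a left module over itself. *)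

(* Defs.v *)
From HB Require Import structures.
From mathcomp Require Import all_boot all_order all_fingroup all_algebra.
From mathcomp Require Import all_classical.

Set Implicit Arguments.
Unset Strict Implicit.
Unset Printing Implicit Defensive.

Import GRing.Theory.
Local Open Scope ring_scope.

(** ** Span of an arbitrary set of vectors *)

Section Span.
Variables (K : fieldType) (vT : vectType K).
Implicit Types (P : set vT) (U W : {vspace vT}).

Lemma vspan_ex P : exists U, (forall v, P v -> v \in U) /\
  (forall W, (forall v, P v -> v \in W) -> (U <= W)%VS).
Proof.
pose Q d := `[< exists U, (forall v, P v -> v \in U) /\ \dim U = d >].
have exQ : exists d, Q d.
  exists (\dim (fullv : {vspace vT})); apply/asboolP.
  by exists fullv; split=> // v _; rewrite memvf.
case: (ex_minnP exQ) => d /asboolP[U [PU dimU]] dmin.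
exists U; split=> // W PW.
have /dmin dle : Q (\dim (U :&: W)%VS).
  apply/asboolP; exists (U :&: W)%VS; split=> // v Pv.
  by rewrite memv_cap PU ?PW.
suff /eqP <- : (U :&: W == U)%VS by apply: capvSr.
by rewrite eqEdim capvSl dimU.
Qed.

(* The smallest subspace containing P. *)
Definition vspan P : {vspace vT} := sval (cid (vspan_ex P)).

Lemma mem_vspan P v : P v -> v \in vspan P.
Proof. by rewrite /vspan; case: cid => U /= [PU _]; apply: PU. Qed.

Lemma vspan_min P W : (forall v, P v -> v \in W) -> (vspan P <= W)%VS.
Proof. by rewrite /vspan; case: cid => U /= [_]; apply. Qed.

End Span.

(** ** Left modules over an algebra A of endomorphisms

   A is a subspace of 'End(E), meant to be closed under composition and to
   contain the identity, and acts on 'End(E) by composition on the left.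
   Since A contains the scalars, its left ideals are subspaces. *)

Section Modules.
Variables (K : fieldType) (E : vectType K).
Implicit Types (A U V W M : {vspace 'End(E)}).

Definition lsubmod A U : Prop :=
  (U <= A)%VS /\ forall a u, a \in A -> u \in U -> (a \o u)%VF \in U.

(* The quotient module U / V is simple. *)
Definition simple_quo A V U : Prop :=
  [/\ lsubmod A V, lsubmod A U, (V <= U)%VS, V != U &
      forall W, lsubmod A W -> (V <= W)%VS -> (W <= U)%VS -> W = V \/ W = U].

Definition simple_lsubmod A U : Prop := simple_quo A 0%VS U.

Definition socle A : {vspace 'End(E)} :=
  vspan [set x | exists2 U, simple_lsubmod A U & x \in U].

(* 0 = M_0 < M_1 < ... < M_l = M, where s is the list of M_1, ..., M_l. *)
Definition comp_series A M (s : seq {vspace 'End(E)}) : Prop :=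
  path (fun V U => `[< simple_quo A V U >]) 0%VS s /\ last 0%VS s = M.

(* The pairs (M_(k-1), M_k). *)
Definition steps (s : seq {vspace 'End(E)}) := zip (0%VS :: s) s.

Definition comp_factor A M V U : Prop :=
  exists2 s, comp_series A M s & (V, U) \in steps s.

(* The number of factors U / V such that P V U in a composition series of M,
   meant for P V U expressing that U / V is isomorphic to a given simple
   module, in which case it does not depend on the series. *)
Definition multiplicity A M (P : {vspace 'End(E)} -> {vspace 'End(E)} -> Prop)
    : nat :=
  xget 0%N [set m | exists2 s, comp_series A M s &
                      m = count (fun F => `[< P F.1 F.2 >]) (steps s)].

Definition direct_summand A M U : Prop :=
  lsubmod A U /\
  exists W, [/\ lsubmod A W, (U + W = M)%VS & (U :&: W = 0)%VS].

End Modules.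

(** ** The Borel-Schur algebra *)

Notation mindex n r := {ffun 'I_r -> 'I_n}.

(* (K^n)^{(x) r}, in coordinates with respect to the basis (e_i). *)
Notation tensor_space K n r := {ffun mindex n r -> K^o}.

Section BorelSchur.
Variables (K : fieldType) (n r : nat).

Local Notation I := (mindex n r).
Local Notation T := (tensor_space K n r).
Implicit Types (i j h k : I) (lam : n.-tuple nat).

(* v_1 (x) ... (x) v_r *)
Definition tens (v : 'I_r -> 'cV[K]_n) : T :=
  [ffun i : I => \prod_(rho < r) v rho (i rho) 0].

Definition ebasis i : T := tens (fun rho => delta_mx (i rho) 0).

Lemma ebasisE i k : ebasis i k = (k == i)%:R.
Proof.
rewrite ffunE; have [->|/eqP neq_ki] := eqVneq.
  by apply: big1 => rho _; rewrite mxE !eqxx.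
have [rho neq] : exists rho, k rho != i rho.
  apply/existsP; rewrite -negb_forall; apply/negP=> /forallP eq_ki.
  by apply: neq_ki; apply/ffunP=> rho; apply/eqP.
by rewrite (bigD1 rho) //= mxE (negPf neq) mul0r.
Qed.

(* The endomorphism e_k |-> F k. *)
Definition on_basis (F : I -> T) : 'End(T) :=
  linfun (fun v : T => \sum_k (v k : K) *: F k).

Lemma on_basisE F v : on_basis F v = \sum_k (v k : K) *: F k.
Proof.
have lin : linear (fun v : T => \sum_k (v k : K) *: F k).
  move=> a u w; rewrite scaler_sumr -big_split /=; apply: eq_bigr => k _.
  by rewrite !ffunE scalerDl scalerA.
pose L := GRing.isLinear.Build _ _ _ _ _ lin.
pose f : {linear T -> T} := HB.pack (fun v : T => \sum_k (v k : K) *: F k) L.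
exact: (lfunE f).
Qed.

Lemma on_basis_e F k : on_basis F (ebasis k) = F k.
Proof.
rewrite on_basisE (bigD1 k) //= big1 => [|j neq]; rewrite ebasisE.
  by rewrite eqxx scale1r addr0.
by rewrite (negPf neq) scale0r.
Qed.

Definition tensor_act (g : 'M[K]_n) : 'End(T) :=
  on_basis (fun k => tens (fun rho => col (k rho) g)).

Lemma tensor_act_tens g v :
  tensor_act g (tens v) = tens (fun rho => g *m v rho).
Proof.
rewrite on_basisE; apply/ffunP=> i; rewrite sum_ffunE ffunE.
under [RHS]eq_bigr => rho _ do rewrite mxE.
rewrite (bigA_distr_bigA (fun rho s => g (i rho) s * v rho s 0)).
apply: eq_bigr => k _; rewrite !ffunE [LHS]mulrC -big_split /=.
by apply: eq_bigr => rho _; rewrite mxE.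
Qed.

(* is_trig_mx means lower triangular. *)
Definition in_Borel (g : 'M[K]_n) : bool := (g \in unitmx) && is_trig_mx g^T.

Definition borel_schur : {vspace 'End(T)} :=
  vspan [set tensor_act g | g in [set g | in_Borel g]].

Definition same_orbit (x y : I * I) : bool :=
  [exists s : 'S_r, [forall rho,
     (y.1 rho == x.1 (s rho)) && (y.2 rho == x.2 (s rho))]].

Definition le_mindex i j : bool := [forall rho, i rho <= j rho]%N.

Definition xi i j : 'End(T) :=
  on_basis (fun k => \sum_(h | same_orbit (i, j) (h, k)) ebasis h).

Definition weight i : n.-tuple nat := [tuple #|[pred rho | i rho == nu]| | nu < n].

Definition Lambda lam : bool := sumn lam == r.

Definition xi_wt lam : 'End(T) :=
  if [pick i | weight i == lam] is Some i then xi i i else 0.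

Lemma weight_eqP i j :
  weight i = weight j -> exists s : 'S_r, forall rho, j rho = i (s rho).
Proof.
move=> eq_w.
have /tuple_permP[s eq_s] : perm_eq [tuple j rho | rho < r] [tuple i rho | rho < r].
  apply/allP=> nu _; rewrite /= !count_map.
  have := congr1 (fun t => tnth t nu) eq_w; rewrite !tnth_mktuple.
  by rewrite !cardE !size_filter => eq_c; apply/eqP/esym.
exists s => rho.
have /(congr1 (fun t => tnth t rho)) : [tuple j rho | rho < r] =
  [tuple tnth [tuple i rho | rho < r] (s rho) | rho < r] by apply: val_inj.
by rewrite !tnth_mktuple.
Qed.

Lemma xi_wt_weight i : xi_wt (weight i) = xi i i.
Proof.
rewrite /xi_wt; case: pickP => [j /eqP eq_w|/(_ i)]; last by rewrite eqxx.
have [s eq_s] := weight_eqP eq_w.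
rewrite /xi; congr on_basis; apply/funext => k; apply: eq_bigl => h.
apply/existsP/existsP => -[t /forallP /= Ht].
  exists (t * s^-1)%g; apply/forallP => rho /=.
  by rewrite eq_s permM permKV Ht.
exists (t * s)%g; apply/forallP => rho /=.
by rewrite permM -eq_s Ht.
Qed.

(* U / V is isomorphic to K_lam as a left module: f induces a K-linear
   isomorphism from U / V to K, and carries the action of each basis element
   xi i j of the algebra on U / V to its action on K_lam, which is the identity
   for xi_wt lam and zero for the others. *)
Definition iso_Klam lam (V U : {vspace 'End(T)}) : Prop :=
  exists f : 'Hom('End(T), K^o),
    [/\ (V <= U)%VS, (f @: U = fullv)%VS, (U :&: lker f = V)%VS &
      forall i j u, le_mindex i j -> u \in U ->
        f (xi i j \o u)%VF = if xi i j == xi_wt lam then f u else 0].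

Definition summand_of_socle lam : Prop :=
  exists2 U, direct_summand borel_schur (socle borel_schur) U
           & iso_Klam lam 0%VS U.

Definition socle_multiplicity lam : nat :=
  multiplicity borel_schur (socle borel_schur) (iso_Klam lam).

End BorelSchur.

(** ** Compositions and partitions *)

(* lambda_k, numbered from 1. *)
Definition part (n : nat) (lam : n.-tuple nat) (k : nat) : nat :=
  nth 0%N lam k.-1.

Definition is_partition (n : nat) (lam : n.-tuple nat) : bool := sorted geq lam.

(* (r, 0, ..., 0) *)
Definition top_weight (n r : nat) : n.-tuple nat :=
  [tuple if val i == 0%N then r else 0%N | i < n].

(* Main.v *)
Require Import Defs.
From HB Require Import structures.
From mathcomp Require Import all_boot all_order all_fingroup all_algebra.
From mathcomp Require Import all_classical.

Set Implicit Arguments.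
Unset Strict Implicit.
Unset Printing Implicit Defensive.

Import GRing.Theory.
Local Open Scope ring_scope.

(** Call highest weight vector an element x of the algebra that some idempotent
   xi_lam fixes and every xi i j with i < j kills. Such an x spans a copy of K_lam.
   Conversely, since xi i j with i < j moves weights strictly upwards, every simple
   submodule is spanned by a highest weight vector (simple_is_hw_line), and every
   simple quotient inside the socle is generated by one (socle_quo_hw). So all parts
   reduce to the question which weights lam have a nonzero highest weight vector.
   This uses that the xi i j with i <= j belong to the algebra and span it: they are
   coefficients of polynomial curves in the image of the Borel group, and the field
   is infinite (code_xi_in).

   As a left module, the algebra is the sum over weights mu of the tensor products
   of divided powers D^mu_1(V_1) (x) ... (x) D^mu_n(V_n), with V_b spanned by the
   first b basis vectors. A highest weight vector is fixed by the unipotent upper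
   triangular matrices.

   Necessary conditions. The weight lam is a partition, for the reason that holds in
   any polynomial representation of GL_2 (hw_dominant). As e_n occurs only in the
   last factor, the root vectors of index (n - 1, n) act on a highest weight vector
   monomial by monomial: they kill a monomial with exponents a and b = lam_n of
   e_(n-1) and e_n in the last factor only if C(a + m, m) = 0 in K for 1 <= m <= b
   (hw_last_binomial). In characteristic 0 this forces lam_n = 0; in characteristic
   p, it forces p ^ (floor (log_p b) + 1) to divide a + 1, where a <= lam_(n-1)
   (binomial_divisible_bound).

   Existence. Let mu have at most the parts mu_1 and mu_n. Then D^mu_1(V_1) is a line
   stable under the Borel group, and the product of its generator with the monomial
   e_1^(a) e_2^(lam_2) ... e_n^(lam_n) is a highest weight vector as soon as the
   binomial coefficients C(b_s + m, m) vanish for s < t and 1 <= m <= lam_t, where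
   b_1 = a and b_s = lam_s otherwise (monomial_hw). It is enough to verify this on
   elementary matrices, which together with the diagonal ones generate the Borel
   group (Borel_generated). The choices a = 0 for the weight (r, 0, ..., 0),
   a = p ^ (floor (log_p lam_2) + 1) - 1 for n = 2, and
   a = p ^ (floor (log_p lam_3) + 2) - 1 for n = 3 give the existence statements. *)

(** * Spans and modules *)

Section LinearClosure.
Variables (K : fieldType) (vT : vectType K).

Definition lin_closed (Q : vT -> Prop) : Prop :=
  Q 0 /\ forall a u v, Q u -> Q v -> Q (a *: u + v).

(** A subspace of maximal dimension among those on which Q holds contains every
   vector v with Q v, since adjoining v gives another such subspace. *)
Lemma lin_closed_vspace (Q : vT -> Prop) : lin_closed Q ->
  exists U : {vspace vT}, forall v, v \in U <-> Q v.
Proof.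
case=> Q0 QD.
pose D d := `[< exists U : {vspace vT}, (forall v, v \in U -> Q v) /\ \dim U = d >].
have exD : exists d, D d.
  exists 0%N; apply/asboolP; exists 0%VS; split; last exact: dimv0.
  by move=> v; rewrite memv0 => /eqP->.
have leD d : D d -> (d <= \dim {:vT})%N.
  by move=> /asboolP[U [_ <-]]; apply: dimvS; apply: subvf.
case: (ex_maxnP exD leD) => d /asboolP[U [QU dimU]] dmax.
exists U => v; split=> [/QU//|Qv].
have /dmax : D (\dim (<[v]> + U)%VS).
  apply/asboolP; exists (<[v]> + U)%VS; split=> // _ /memv_addP[_ /vlineP[k ->] [u uU ->]].
  exact/QD/QU.
rewrite -dimU => dim_le.
have /eqP -> : U == (<[v]> + U)%VS by rewrite eqEdim addvSr.
by apply: (subvP (addvSl _ _)); apply: memv_line.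
Qed.

(** The form in which the minimality of a span is used: induction on the
   construction of its vectors. *)
Lemma vspan_ind (P Q : vT -> Prop) : lin_closed Q -> (forall v, P v -> Q v) ->
  forall v, v \in vspan P -> Q v.
Proof.
move=> /lin_closed_vspace[W QW] PQ v vP; apply/QW.
by apply: (subvP (vspan_min _)) vP => u /PQ/QW.
Qed.

End LinearClosure.

Section Modules.
Variables (K : fieldType) (E : vectType K) (A : {vspace 'End(E)}).
Implicit Types (U V W M : {vspace 'End(E)}).

Lemma lsubmod0 : lsubmod A 0.
Proof.
split=> [|a u _]; first exact: sub0v.
by rewrite memv0 => /eqP->; rewrite comp_lfun0r mem0v.
Qed.

Lemma lsubmodD U V : lsubmod A U -> lsubmod A V -> lsubmod A (U + V)%VS.
Proof.
move=> [UA AU] [VA AV]; split=> [|a _ aA /memv_addP[u uU [v vV ->]]].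
  by rewrite subv_add UA.
by rewrite comp_lfunDr memv_add ?AU ?AV.
Qed.

Lemma lsubmodI U V : lsubmod A U -> lsubmod A V -> lsubmod A (U :&: V)%VS.
Proof.
move=> [UA AU] [VA AV]; split=> [|a u aA].
  exact: subv_trans (capvSl _ _) UA.
by rewrite !memv_cap => /andP[uU uV]; rewrite AU ?AV.
Qed.

Lemma simple_le_socle U : simple_lsubmod A U -> (U <= socle A)%VS.
Proof. by move=> simU; apply/subvP => u uU; apply: mem_vspan; exists U. Qed.

Lemma socle_le M : (forall U, simple_lsubmod A U -> (U <= M)%VS) ->
  (socle A <= M)%VS.
Proof. by move=> simM; apply: vspan_min => v [U /simM/subvP UM /UM]. Qed.

Lemma lsubmod_socle : lsubmod A (socle A).
Proof.
split; first by apply: socle_le => U [_ [UA _] _ _ _].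
move=> a u aA; apply: (@vspan_ind _ _ _ (fun v => (a \o v)%VF \in socle A)); last first.
  move=> v [U simU vU]; have [_ [_ AU] _ _ _] := simU.
  exact: (subvP (simple_le_socle simU)) (AU _ _ aA vU).
split=> [|c v w av aw]; first by rewrite comp_lfun0r mem0v.
by rewrite comp_lfunDr -comp_lfunZr rpredD ?rpredZ.
Qed.

Lemma max_disjoint U M : exists W, [/\ lsubmod A W, (W <= M)%VS,
    (U :&: W = 0)%VS &
    forall W', lsubmod A W' -> (W' <= M)%VS -> (U :&: W' = 0)%VS ->
      (\dim W' <= \dim W)%N].
Proof.
pose D d := `[< exists W, [/\ lsubmod A W, (W <= M)%VS, (U :&: W = 0)%VS
                            & \dim W = d] >].
have exD : exists d, D d.
  exists 0%N; apply/asboolP; exists 0%VS; split; rewrite ?dimv0 ?sub0v ?capv0 //.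
  exact: lsubmod0.
have leD d : D d -> (d <= \dim {:'End(E)})%N.
  by move=> /asboolP[W [_ _ _ <-]]; apply: dimvS; apply: subvf.
case: (ex_maxnP exD leD) => d /asboolP[W [AW WM UW dimW]] dmax.
exists W; split=> // W' AW' W'M UW'; rewrite dimW; apply: dmax.
by apply/asboolP; exists W'.
Qed.

Lemma simple_disjoint U W : simple_lsubmod A U -> lsubmod A W ->
  ~ (U <= W)%VS -> (U :&: W = 0)%VS.
Proof.
move=> [_ AU _ _ minU] AW nUW.
have [//|eqU] := minU _ (lsubmodI AU AW) (sub0v _) (capvSl _ _).
by case: nUW; rewrite -eqU capvSr.
Qed.

(** A submodule W of the socle that is maximal among those disjoint from U is a
   complement of U: a simple submodule outside U + W could be added to W. *)
Lemma simple_direct_summand U : simple_lsubmod A U ->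
  direct_summand A (socle A) U.
Proof.
move=> simU; have [_ AU _ _ _] := simU; split=> //.
have [W [AW Wsoc UW0 maxW]] := max_disjoint U (socle A).
exists W; split=> //; apply/eqP; rewrite eqEsubv subv_add simple_le_socle //= Wsoc.
apply: socle_le => U' simU'; have [_ AU' _ U'0 _] := simU'.
apply/negPn/negP => nU'.
have U'UW := simple_disjoint simU' (lsubmodD AU AW) (negP nU').
have W'W0 : (U' :&: W = 0)%VS.
  by apply/eqP; rewrite -subv0 -U'UW capvS // addvSr.
have : (\dim (U' + W) <= \dim W)%N.
  apply: maxW; first exact: lsubmodD.
    by rewrite subv_add simple_le_socle.
  apply/eqP; rewrite -subv0; apply/subvP => u; rewrite memv_cap memv0.
  case/andP=> uU /memv_addP[u' u'U' [w wW def_u]].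
  have u'0 : u' = 0.
    apply/eqP; rewrite -memv0 -U'UW memv_cap u'U' /=.
    by rewrite -[u'](addrK w) -def_u memv_add // rpredN.
  by rewrite -memv0 -UW0 memv_cap uU def_u u'0 add0r.
rewrite dimv_disjoint_sum // -[leqRHS]add0n leq_add2r leqn0 dimv_eq0.
by move=> /eqP U'_0; rewrite U'_0 eqxx in U'0.
Qed.

(** A proper submodule of maximal dimension is the last step but one. *)
Lemma comp_series_exists M : lsubmod A M -> exists s, comp_series A M s.
Proof.
have [d] := ubnP (\dim M); elim: d M => // d IHd M le_d AM.
have [->|nzM] := eqVneq M 0%VS; first by exists [::].
pose D d := `[< exists W, [/\ lsubmod A W, (W <= M)%VS, W != M & \dim W = d] >].
have exD : exists d, D d.
  exists 0%N; apply/asboolP; exists 0%VS.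
  by split; rewrite ?dimv0 ?sub0v // 1?eq_sym //; apply: lsubmod0.
have leD e : D e -> (e <= \dim M)%N.
  by move=> /asboolP[W [_ WM _ <-]]; apply: dimvS.
case: (ex_maxnP exD leD) => e /asboolP[V [AV VM neqVM dimV]] dmax.
have ltVM : (\dim V < \dim M)%N.
  by rewrite ltnNge; apply: contra neqVM; rewrite eqEdim VM.
have [s [path_s last_s]] := IHd V (leq_trans ltVM le_d) AV.
exists (rcons s M); split; last exact: last_rcons.
rewrite rcons_path path_s last_s; apply/asboolP; split=> // W AW VW WM.
have [->|neqWM] := eqVneq W M; [by right|left].
apply/esym/eqP; rewrite eqEdim VW dimV; apply: dmax; apply/asboolP.
by exists W.
Qed.

Lemma simple_quo_le V U : simple_quo A V U -> (V <= U)%VS.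
Proof. by case. Qed.

(** Looking for the first term that contains a given vector finds a factor of
   prescribed type in every composition series, so that multiplicities can be
   shown to be nonzero without the Jordan-Hoelder theorem. *)
Lemma comp_series_step M s x : comp_series A M s -> x \in M -> x != 0 ->
  exists V U, [/\ (V, U) \in steps s, simple_quo A V U, x \in U & x \notin V].
Proof.
case=> path_s last_s xM nzx.
have x0 : x \notin (0%VS : {vspace 'End(E)}) by rewrite memv0.
rewrite -last_s in xM; clear last_s M nzx.
rewrite /steps; elim: s (0%VS) path_s xM x0 => [|U s IHs] V /=.
  by move=> _ ->.
case/andP=> /asboolP simVU path_s xM xV.
have [xU|xU] := boolP (x \in U).
  by exists V, U; split=> //; rewrite inE eqxx.
have [V' [U' [VU' simU xU' xV']]] := IHs U path_s xM xU.
by exists V', U'; split=> //; rewrite inE VU' orbT.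
Qed.

Lemma comp_factor_simple M V U : comp_factor A M V U ->
  simple_quo A V U /\ (U <= M)%VS.
Proof.
case=> s [path_s <-]; rewrite /steps.
elim: s (0%VS) path_s => [|W s IHs] V0 //= /andP[/asboolP simW path_s].
rewrite inE => /orP[/eqP[-> ->]|]; last exact: IHs.
split=> //; elim: s W path_s {simW IHs} => [|W' s IHs] W /=; first by rewrite subvv.
by case/andP=> /asboolP/simple_quo_le WW' /IHs; apply: subv_trans.
Qed.

Lemma line_simple x : x != 0 -> lsubmod A <[x]> -> simple_lsubmod A <[x]>.
Proof.
move=> nzx Ax; split; rewrite ?sub0v //; first exact: lsubmod0.
  by apply: contraNneq nzx => eq0; rewrite -memv0 eq0 memv_line.
move=> W AW _ Wx; have [->|nzW] := eqVneq W 0%VS; [by left|right].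
apply/eqP; rewrite eqEdim Wx dim_vline nzx lt0n dimv_eq0.
by rewrite nzW.
Qed.

Lemma multiplicity_neq0 M (P : {vspace 'End(E)} -> {vspace 'End(E)} -> Prop) :
    lsubmod A M ->
    (forall s, comp_series A M s -> exists2 F, F \in steps s & P F.1 F.2) ->
  multiplicity A M P != 0%N.
Proof.
move=> AM exP; rewrite /multiplicity; case: xgetP => [m -> [s ser_s ->]|none].
  rewrite -lt0n -has_count; apply/hasP; have [F sF PF] := exP s ser_s.
  by exists F => //; apply/asboolP.
have [s ser_s] := comp_series_exists AM.
by case: (none (count (fun F => `[< P F.1 F.2 >]) (steps s))); exists s.
Qed.

End Modules.

(** * Matrix entries and weights *)

(** The statement on words of equal weight, for an arbitrary finite alphabet; pairs
   of multi-indices, or marked multi-indices, are words in such alphabets. *)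
Lemma perm_of_fibers (F : finType) (r : nat) (f g : 'I_r -> F) :
  (forall c, #|[pred rho | f rho == c]| = #|[pred rho | g rho == c]|) ->
  exists s : 'S_r, forall rho, g rho = f (s rho).
Proof.
move=> eq_fib.
have [|s Hs] := @weight_eqP #|F| r [ffun rho => enum_rank (f rho)]
                                   [ffun rho => enum_rank (g rho)].
  apply: eq_from_tnth => c; rewrite !tnth_mktuple.
  have fib (h : 'I_r -> F) :
    #|[pred rho | [ffun rho => enum_rank (h rho)] rho == c]|
      = #|[pred rho | h rho == enum_val c]|.
    by apply: eq_card => rho; rewrite !inE ffunE -(inj_eq enum_val_inj) enum_rankK.
  by rewrite !fib.
by exists s => rho; have := Hs rho; rewrite !ffunE => /enum_rank_inj.
Qed.

Section Coefficients.
Variables (K : fieldType) (n r : nat).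
Local Notation I := (mindex n r).
Local Notation T := (tensor_space K n r).
Implicit Types (i j h k l : I) (x y a : 'End(T)) (g : 'M[K]_n).
Implicit Types lam : n.-tuple nat.

Definition entry x h k : K := x (ebasis K k) h.

Lemma tens_basis (v : T) : v = \sum_k (v k : K) *: ebasis K k.
Proof.
apply/ffunP => h; rewrite sum_ffunE (bigD1 h) //= big1 => [|k neq].
  by rewrite ffunE ebasisE eqxx addr0 [_ *: _]mulr1.
by rewrite ffunE ebasisE eq_sym (negPf neq) scaler0.
Qed.

Lemma entry_inj x y : (forall h k, entry x h k = entry y h k) -> x = y.
Proof.
move=> eq_xy; apply/lfunP => v; rewrite (tens_basis v) !linear_sum.
apply: eq_bigr => k _; rewrite !linearZ /=; congr (_ *: _).
by apply/ffunP => h; apply: eq_xy.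
Qed.

Lemma entry_comp x y h k : entry (x \o y)%VF h k = \sum_l entry x h l * entry y l k.
Proof.
rewrite /entry comp_lfunE [X in x X]tens_basis linear_sum sum_ffunE.
by apply: eq_bigr => l _; rewrite linearZ /= ffunE mulrC.
Qed.

Lemma entry_lin c x y h k : entry (c *: x + y) h k = c * entry x h k + entry y h k.
Proof. by rewrite /entry add_lfunE scale_lfunE !ffunE. Qed.

Lemma entryZ c x h k : entry (c *: x) h k = c * entry x h k.
Proof. by rewrite /entry scale_lfunE !ffunE. Qed.

Lemma entry0 h k : entry 0 h k = 0.
Proof. by rewrite /entry zero_lfunE ffunE. Qed.

Lemma entry1 h k : entry \1%VF h k = (h == k)%:R.
Proof. by rewrite /entry id_lfunE ebasisE. Qed.

Lemma entry_sum (J : Type) (s : seq J) (P : pred J) (F : J -> 'End(T)) h k :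
  entry (\sum_(j <- s | P j) F j) h k = \sum_(j <- s | P j) entry (F j) h k.
Proof. by rewrite /entry sum_lfunE sum_ffunE. Qed.

Lemma entry_on_basis (P : rel I) h k :
  entry (on_basis (fun k => \sum_(h | P h k) ebasis K h)) h k = (P h k)%:R.
Proof.
rewrite /entry on_basis_e sum_ffunE.
case: (boolP (P h k)) => Phk.
  rewrite (bigD1 h) //= ebasisE eqxx big1 ?addr0 // => l /andP[_ neq].
  by rewrite ebasisE eq_sym (negPf neq).
apply: big1 => l Plk; rewrite ebasisE; case: eqP => // eq_hl.
by rewrite eq_hl Plk in Phk.
Qed.

Lemma entry_xi i j h k : entry (xi K i j) h k = (same_orbit (i, j) (h, k))%:R.
Proof. exact: (entry_on_basis (fun h k => same_orbit (i, j) (h, k))). Qed.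

Lemma entry_tensor_act g h k : entry (tensor_act r g) h k = \prod_rho g (h rho) (k rho).
Proof.
by rewrite /entry on_basis_e ffunE; apply: eq_bigr => rho _; rewrite mxE.
Qed.

Lemma tensor_actM (g g' : 'M[K]_n) :
  tensor_act r (g *m g') = (tensor_act r g \o tensor_act r g')%VF.
Proof.
apply: entry_inj => h k; congr (fun_of_fin _ h).
by rewrite comp_lfunE /ebasis !tensor_act_tens; congr tens; apply/funext => rho;
   rewrite mulmxA.
Qed.

Lemma same_orbitP i j h k : reflect
  (exists s : 'S_r, forall rho, h rho = i (s rho) /\ k rho = j (s rho))
  (same_orbit (i, j) (h, k)).
Proof.
apply: (iffP existsP) => [[s /forallP Hs]|[s Hs]]; exists s.
  by move=> rho; have /andP[/eqP ? /eqP ?] := Hs rho.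
by apply/forallP => rho /=; have [-> ->] := Hs rho; rewrite !eqxx.
Qed.

Lemma same_orbit_refl i j : same_orbit (i, j) (i, j).
Proof. by apply/same_orbitP; exists 1%g => rho; rewrite perm1. Qed.

Lemma same_orbit_le i j h k :
  same_orbit (i, j) (h, k) -> le_mindex i j -> le_mindex h k.
Proof.
case/same_orbitP=> s Hs /forallP le_ij; apply/forallP => rho.
by have [-> ->] := Hs rho.
Qed.

Lemma tnth_weight i nu : tnth (weight i) nu = #|[pred rho | i rho == nu]|.
Proof. by rewrite tnth_mktuple. Qed.

Lemma weight_perm i j (s : 'S_r) : (forall rho, j rho = i (s rho)) ->
  weight j = weight i.
Proof.
move=> Hs; apply: eq_from_tnth => nu; rewrite !tnth_weight.
rewrite -(card_imset (mem [pred rho | j rho == nu]) (@perm_inj _ s)).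
apply: eq_card => rho; rewrite !inE.
apply/imsetP/idP => [[rho' ]|].
  by rewrite inE Hs => ? ->.
by exists (s^-1%g rho); rewrite ?inE ?Hs permKV.
Qed.

Lemma same_orbit_weight i j h k : same_orbit (i, j) (h, k) ->
  weight h = weight i /\ weight k = weight j.
Proof.
by case/same_orbitP=> s Hs; split; apply: (weight_perm (s := s)) => rho; have [] := Hs rho.
Qed.

Lemma same_orbit_diag i h k :
  same_orbit (i, i) (h, k) = (h == k) && (weight k == weight i).
Proof.
apply/same_orbitP/andP => [[s Hs]|[/eqP-> /eqP eq_w]].
  split; last by apply/eqP/(weight_perm (s := s)) => rho; have [] := Hs rho.
  by apply/eqP/ffunP => rho; have [-> ->] := Hs rho.
by have [s Hs] := weight_eqP (esym eq_w); exists s => rho; split; apply: Hs.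
Qed.

Lemma entry_xi_wt lam h k :
  entry (xi_wt K r lam) h k = ((h == k) && (weight k == lam))%:R.
Proof.
rewrite /xi_wt; case: pickP => [i /eqP <-|none].
  by rewrite entry_xi same_orbit_diag.
by rewrite none andbF entry0.
Qed.

Lemma entry_xi_wtl lam x h k :
  entry (xi_wt K r lam \o x)%VF h k = (weight h == lam)%:R * entry x h k.
Proof.
rewrite entry_comp (bigD1 h) //= entry_xi_wt eqxx big1 ?addr0 // => l neq.
by rewrite entry_xi_wt eq_sym (negPf neq) mul0r.
Qed.

Lemma weight_sum i : (\sum_(nu < n) tnth (weight i) nu = r)%N.
Proof.
transitivity (\sum_(nu < n) \sum_(rho < r) (i rho == nu))%N.
  apply: eq_bigr => nu _; rewrite tnth_weight -sum1_card big_mkcond /=.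
  by apply: eq_bigr => rho _; rewrite inE; case: eqP.
rewrite exchange_big /= -[RHS]card_ord -sum1_card; apply: eq_bigr => rho _.
rewrite (bigD1 (i rho)) //= eqxx big1 // => nu neq.
by rewrite eq_sym (negPf neq).
Qed.

Lemma sumn_tuple lam : (sumn lam = \sum_(nu < n) tnth lam nu)%N.
Proof. by rewrite sumnE big_tuple. Qed.

Lemma Lambda_weight i : Lambda r (weight i).
Proof. by rewrite /Lambda sumn_tuple weight_sum. Qed.

Lemma Lambda_ex lam : Lambda r lam -> exists i, weight i = lam.
Proof.
move=> /eqP sum_lam.
pose w := flatten [seq nseq (tnth lam nu) nu | nu <- enum 'I_n].
have size_w : size w == r.
  rewrite size_flatten /shape -map_comp sumnE big_map -sum_lam sumn_tuple.
  by rewrite big_enum /=; apply/eqP/eq_bigr => nu _; rewrite size_nseq.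
exists [ffun rho => tnth (Tuple size_w) rho]; apply: eq_from_tnth => nu.
rewrite tnth_weight; transitivity (count_mem nu w).
  rewrite -[w]/(tval (Tuple size_w)) -[in RHS](map_tnth_enum (Tuple size_w)).
  rewrite count_map cardE size_filter -enumT.
  apply: eq_count => rho; rewrite /=.
  change ([ffun rho => tnth (Tuple size_w) rho] rho == nu = (tnth (Tuple size_w) rho == nu)).
  by rewrite ffunE.
rewrite count_flatten -map_comp sumnE big_map big_enum /= (bigD1 nu) //=.
rewrite count_nseq /= eqxx mul1n big1 ?addn0 // => nu' neq.
by rewrite count_nseq /= (negPf neq).
Qed.

(** A function of the weight that every xi i j with i < j changes: it measures how
   far a weight is from the top one. *)
Definition height i := (\sum_(rho < r) i rho)%N.

Lemma height_weight i j : weight i = weight j -> height i = height j.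
Proof.
move=> /weight_eqP[s Hs]; rewrite /height [LHS](reindex_inj (@perm_inj _ s)).
by apply: eq_bigr => rho _; rewrite Hs.
Qed.

Lemma height_lt i j : le_mindex i j -> i != j -> (height i < height j)%N.
Proof.
move=> /forallP le_ij neq_ij; rewrite ltn_neqAle leq_sum ?andbT //.
apply: contra neq_ij => /eqP eq_h; apply/eqP/ffunP => rho; apply/val_inj/eqP.
have := leqif_sum (fun (rho : 'I_r) (_ : true) => leqif_eq (le_ij rho)).
by move=> [_]; rewrite -/(height i) -/(height j) eq_h eqxx => /esym/forallP/(_ rho).
Qed.

End Coefficients.

(** * The basis of the Borel-Schur algebra *)

Lemma poly_infinite_roots (K : fieldType) (f : {poly K}) :
  infinite_set [set: K]%classic -> (forall t, t != 0 -> f.[t] = 0) -> f = 0.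
Proof.
move=> infK f0; apply: contraTeq isT => nzf.
have [D _ le_D] := infinite_set_fset (size f).+1 infK.
pose s := rem 0 (finmap.enum_fset D).
have uniq_s : uniq s by rewrite rem_uniq ?finmap.fset_uniq.
have root_s : all (root f) s.
  apply/allP => t; rewrite mem_rem_uniq ?finmap.fset_uniq // inE => /andP[nzt _].
  exact/eqP/f0.
have := max_poly_roots nzf root_s uniq_s; rewrite ltnNge => /negP[].
rewrite -ltnS; apply: leq_trans le_D _; rewrite /s.
have [D0|D0] := boolP (0 \in finmap.enum_fset D); last by rewrite rem_id ?leqW.
by rewrite size_rem // prednK //; case: (finmap.enum_fset D) D0.
Qed.

(** The coordinates modulo W of a polynomial curve that lies in W are polynomials
   with infinitely many roots. *)
Lemma coefs_in_vspace (K : fieldType) (vT : vectType K) (W : {vspace vT})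
    (M : nat) (v : nat -> vT) : infinite_set [set: K]%classic ->
    (forall t, t != 0 -> \sum_(e < M) t ^+ e *: v e \in W) ->
  forall e, (e < M)%N -> v e \in W.
Proof.
move=> infK vW e lt_eM.
have memW w : (w \in W) = (w - projv W w == 0).
  apply/idP/eqP => [/projv_id->|/eqP]; first by rewrite subrr.
  by rewrite subr_eq0 => /eqP->; apply: memv_proj.
pose pi c w := coord (vbasis {:vT}) c (w - projv W w).
have pi_sum c t : pi c (\sum_(e < M) t ^+ e *: v e) = \sum_(e < M) t ^+ e * pi c (v e).
  rewrite /pi linear_sum -sumrB linear_sum; apply: eq_bigr => k _.
  by rewrite linearZ /= -scalerBr linearZ.
rewrite memW (coord_vbasis (memvf (_ - _))) big1 // => c _.
rewrite -/(pi c (v e)); suff -> : pi c (v e) = 0 by rewrite scale0r.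
have /polyP/(_ e) : \poly_(e < M) pi c (v e) = 0.
  apply: poly_infinite_roots => // t nzt; rewrite horner_poly.
  have := vW t nzt; rewrite memW => /eqP/(congr1 (coord (vbasis {:vT}) c)).
  rewrite -/(pi _ _) pi_sum linear0 => pi0.
  by rewrite -[RHS]pi0; apply: eq_bigr => k _; rewrite mulrC.
by rewrite coef_poly lt_eM coef0.
Qed.

Lemma digits_inj (B C : nat) (a b : nat -> nat) :
    (forall c, a c < B)%N -> (forall c, b c < B)%N ->
    (\sum_(c < C) a c * B ^ c = \sum_(c < C) b c * B ^ c)%N ->
  forall c, (c < C)%N -> a c = b c.
Proof.
elim: C a b => // C IHC a b a_lt b_lt; rewrite !big_ord_recl /= !muln1.
have shift (d : nat -> nat) :
    (\sum_(c < C) d (bump 0 c) * B ^ bump 0 c = (\sum_(c < C) d c.+1 * B ^ c) * B)%N.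
  by rewrite big_distrl; apply: eq_bigr => c _; rewrite /= /bump add1n expnSr mulnA.
rewrite !shift => eq_ab.
have B_gt0 : (0 < B)%N by apply: leq_trans (a_lt 0%N).
have eq0 : a 0%N = b 0%N.
  have := congr1 (modn^~ B) eq_ab.
  by rewrite ![(_ + _ * B)%N]addnC !modnMDl !modn_small.
case=> [|c] lt_cC //; apply: (IHC (a \o succn) (b \o succn)) => //=.
by move: eq_ab; rewrite eq0 => /addnI/eqP; rewrite eqn_pmul2r // => /eqP.
Qed.

Section BorelSchurBasis.
Variables (K : fieldType) (n r : nat).
Local Notation I := (mindex n r).
Local Notation T := (tensor_space K n r).
Local Notation S := (borel_schur K n r).
Implicit Types (i j h k l : I) (x y a : 'End(T)) (g : 'M[K]_n).

(** The orbit of (h, k) is determined by the numbers of places at which the various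
   pairs of letters occur. As these numbers are at most r, they can be read off as
   the digits of this number in base r + 1. *)
Definition orbit_code h k : nat :=
  (\sum_rho r.+1 ^ (enum_rank (h rho, k rho) : 'I_#|{: 'I_n * 'I_n}|))%N.

Lemma orbit_code_digits h k : orbit_code h k =
  (\sum_(c < #|{: 'I_n * 'I_n}|)
     #|[pred rho | enum_rank (h rho, k rho) == c :> nat]| * r.+1 ^ c)%N.
Proof.
rewrite /orbit_code (partition_big (fun rho => enum_rank (h rho, k rho)) predT) //=.
apply: eq_bigr => c _; rewrite -sum_nat_const.
by apply: eq_big => rho //; move=> /eqP->.
Qed.

Lemma orbit_code_eq i j h k :
  same_orbit (i, j) (h, k) = (orbit_code i j == orbit_code h k).
Proof.
apply/same_orbitP/eqP => [[s Hs]|].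
  rewrite /orbit_code [LHS](reindex_inj (@perm_inj _ s)).
  by apply: eq_bigr => rho _; have [-> ->] := Hs rho.
pose d h k c := #|[pred rho | enum_rank (h rho, k rho) == c :> nat]|.
have d_lt h' k' c : (d h' k' c < r.+1)%N.
  by rewrite ltnS -[leqRHS]card_ord max_card.
rewrite !orbit_code_digits => /(digits_inj (d_lt i j) (d_lt h k)) eq_d.
have [|s Hs] := @perm_of_fibers _ r (fun rho => (i rho, j rho))
                                    (fun rho => (h rho, k rho)).
  move=> c; have fib (f : 'I_r -> 'I_n * 'I_n) : #|[pred rho | f rho == c]|
      = #|[pred rho | enum_rank (f rho) == enum_rank c :> nat]|.
    by apply: eq_card => rho; rewrite !inE -(inj_eq enum_rank_inj).
  by rewrite !fib; apply: (eq_d (enum_rank c)).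
by exists s => rho; case: (Hs rho).
Qed.

Definition code_bound := (\max_(q : I * I) orbit_code q.1 q.2).+1.

Lemma orbit_code_lt h k : (orbit_code h k < code_bound)%N.
Proof. by rewrite ltnS (leq_bigmax (h, k)). Qed.

(** The basis element xi i j with i <= j whose pair (i, j) has code e, or zero
   if there is no such pair. *)
Definition code_xi e : 'End(T) :=
  on_basis (fun k => \sum_(h | le_mindex h k && (orbit_code h k == e)) ebasis K h).

Lemma entry_code_xi e h k :
  entry (code_xi e) h k = (le_mindex h k && (orbit_code h k == e))%:R.
Proof. exact: (entry_on_basis _ (fun h k => le_mindex h k && (orbit_code h k == e))). Qed.

Lemma code_xi_orbit i j : le_mindex i j -> code_xi (orbit_code i j) = xi K i j.
Proof.
move=> le_ij; apply: entry_inj => h k; rewrite entry_code_xi entry_xi orbit_code_eq eq_sym.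
case: eqP => [eq_c|_]; rewrite ?andbF // andbT.
by rewrite (same_orbit_le _ le_ij) // orbit_code_eq eq_c.
Qed.

Lemma code_xi0 e : (forall i j, le_mindex i j -> orbit_code i j != e) -> code_xi e = 0.
Proof.
move=> none; apply: entry_inj => h k; rewrite entry_code_xi entry0.
by case: (boolP (le_mindex h k)) => // /none/negPf->.
Qed.

Definition triangular x : Prop := forall h k, entry x h k != 0 -> le_mindex h k.
Definition invariant_entry x : Prop :=
  forall i j h k, same_orbit (i, j) (h, k) -> entry x h k = entry x i j.

(** The coordinates of x are its entries at one pair of indices in each orbit. *)
Lemma code_xi_expansion x : triangular x -> invariant_entry x ->
  exists c : nat -> K, x = \sum_(e < code_bound) c e *: code_xi e.
Proof.
move=> trix invx.
pose c e := if [pick q : I * I | le_mindex q.1 q.2 && (orbit_code q.1 q.2 == e)]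
            is Some q then entry x q.1 q.2 else 0.
exists c; apply: entry_inj => h k; rewrite entry_sum.
rewrite (bigD1 (Ordinal (orbit_code_lt h k))) //= big1 ?addr0 => [|e neq].
  rewrite entryZ entry_code_xi eqxx andbT; have [le_hk|] := boolP (le_mindex h k).
    rewrite mulr1 /c; case: pickP => [[i j] /= /andP[_ eq_c]|/(_ (h, k))].
      by apply: invx; rewrite orbit_code_eq.
    by rewrite /= le_hk eqxx.
  by move=> nle; apply/eqP; rewrite mulr0; apply: contraNT nle => /trix.
rewrite entryZ entry_code_xi; case: eqP => [eq_e|_]; last by rewrite andbF mulr0.
by case/eqP: neq; apply: val_inj; rewrite /= eq_e.
Qed.

Lemma tensor_act_triangular g : is_trig_mx g^T -> triangular (tensor_act r g).
Proof.
move=> /is_trig_mxP trig h k; rewrite entry_tensor_act => nz.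
apply/forallP => rho; rewrite leqNgt; apply: contra nz => lt.
by have := trig _ _ lt; rewrite (bigD1 rho) //= mxE => ->; rewrite mul0r.
Qed.

Lemma tensor_act_invariant g : invariant_entry (tensor_act r g).
Proof.
move=> i j h k /same_orbitP[s Hs]; rewrite !entry_tensor_act.
rewrite [RHS](reindex_inj (@perm_inj _ s)); apply: eq_bigr => rho _.
by have [-> ->] := Hs rho.
Qed.

Lemma borel_schur_entry x : x \in S -> triangular x /\ invariant_entry x.
Proof.
apply: (@vspan_ind _ _ _ (fun x => triangular x /\ invariant_entry x)); last first.
  move=> _ [g /andP[_ trig] <-].
  by split; [apply: tensor_act_triangular | apply: tensor_act_invariant].
split=> [|c u v [triu invu] [triv invv]].
  by split=> [h k|i j h k _]; rewrite !entry0 ?eqxx.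
split=> [h k|i j h k oij]; rewrite !entry_lin; last by rewrite (invu _ _ _ _ oij) (invv _ _ _ _ oij).
have [/eqP u0|/triu//] := boolP (entry u h k == 0).
have [/eqP v0|/triv//] := boolP (entry v h k == 0).
by rewrite u0 v0 mulr0 addr0 eqxx.
Qed.

Lemma in_BorelP g : reflect
  ((forall s u : 'I_n, (u < s)%N -> g s u = 0) /\ forall s, g s s != 0) (in_Borel g).
Proof.
have trigP : is_trig_mx g^T <-> forall s u : 'I_n, (u < s)%N -> g s u = 0.
  split=> [/is_trig_mxP trig s u lt_us|tri]; first by have := trig u s lt_us; rewrite mxE.
  by apply/is_trig_mxP => s u lt_su; rewrite mxE tri.
have unitE : is_trig_mx g^T -> (g \in unitmx) = [forall s, g s s != 0].
  move=> trig; rewrite -unitmx_tr unitmxE det_trig // unitfE.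
  apply/prodf_neq0/forallP => [nz s|nz s _]; last by rewrite mxE.
  by have := nz s isT; rewrite mxE.
apply: (iffP andP) => [[unit_g trig]|[tri nz]].
  by split; [apply/trigP | apply/forallP; rewrite -unitE].
have trig : is_trig_mx g^T by apply/trigP.
by split=> //; rewrite unitE //; apply/forallP.
Qed.

Lemma tensor_act_in g : in_Borel g -> tensor_act r g \in S.
Proof. by move=> Bg; apply: mem_vspan; exists g. Qed.

Hypothesis infK : infinite_set [set: K]%classic.

(** Take the curve of upper triangular matrices whose entries are powers of t with
   exponents the powers of r + 1. The tensor power of its value at t is the sum of
   the t ^ e code_xi e, since the exponents of t separate the orbits of pairs of
   multi-indices. The coefficients of a curve in a subspace lie in the subspace. *)
Lemma code_xi_in e : code_xi e \in S.
Proof.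
have [lt_e|ge_e] := ltnP e code_bound; last first.
  rewrite code_xi0 ?mem0v // => i j _; apply: contraTneq ge_e => <-.
  by rewrite -ltnNge orbit_code_lt.
apply: (coefs_in_vspace infK) lt_e => t nzt.
pose g : 'M[K]_n := \matrix_(s, u)
  if (s <= u)%N then t ^+ (r.+1 ^ (enum_rank (s, u) : 'I_#|{: 'I_n * 'I_n}|)) else 0.
suff <- : tensor_act r g = \sum_(e < code_bound) t ^+ e *: code_xi e.
  apply/tensor_act_in/in_BorelP; split=> [s u lt_us|s]; rewrite mxE.
    by rewrite leqNgt lt_us.
  by rewrite leqnn expf_neq0.
apply: entry_inj => h k; rewrite entry_tensor_act entry_sum.
rewrite [RHS](bigD1 (Ordinal (orbit_code_lt h k))) //= [X in _ + X]big1 ?addr0 => [|e' neq].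
  rewrite entryZ entry_code_xi eqxx andbT /orbit_code -prodrXr.
  have [/forallP le_hk|/forallPn[rho nle]] := boolP (le_mindex h k).
    by rewrite mulr1; apply: eq_bigr => rho _; rewrite mxE le_hk.
  by rewrite mulr0 (bigD1 rho) //= mxE (negPf nle) mul0r.
rewrite entryZ entry_code_xi; case: eqP => [eq_e|_]; last by rewrite andbF mulr0.
by case/eqP: neq; apply: val_inj; rewrite /= eq_e.
Qed.

Lemma xi_in i j : le_mindex i j -> xi K i j \in S.
Proof. by move=> le_ij; rewrite -code_xi_orbit // code_xi_in. Qed.

Lemma borel_schurP x : (x \in S) <-> (triangular x /\ invariant_entry x).
Proof.
split=> [/borel_schur_entry//|[trix invx]].
have [c ->] := code_xi_expansion trix invx.
by apply: rpred_sum => e _; rewrite rpredZ ?code_xi_in.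
Qed.

(** The xi i j with i <= j span the algebra. *)
Lemma borel_schur_ind (Q : 'End(T) -> Prop) : lin_closed Q ->
  (forall i j, le_mindex i j -> Q (xi K i j)) -> forall x, x \in S -> Q x.
Proof.
move=> /lin_closed_vspace[W QW] Qxi x /borel_schur_entry[trix invx].
have [c ->] := code_xi_expansion trix invx.
apply/QW/rpred_sum => e _; rewrite rpredZ //.
have [[i [j [le_ij <-]]]|none] := pselect (exists i j, le_mindex i j /\ orbit_code i j = e).
  by rewrite code_xi_orbit //; apply/QW/Qxi.
rewrite code_xi0 ?mem0v // => i j le_ij; apply/eqP => eq_e.
by apply: none; exists i, j.
Qed.

End BorelSchurBasis.

(** * Highest weight vectors and the socle *)

Section HighestWeight.
Variables (K : fieldType) (n r : nat).
Local Notation I := (mindex n r).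
Local Notation T := (tensor_space K n r).
Local Notation S := (borel_schur K n r).
Implicit Types (i j h k l : I) (x y a u : 'End(T)) (g : 'M[K]_n).
Implicit Types lam : n.-tuple nat.

Definition strictly_killed x : Prop :=
  forall i j, le_mindex i j -> i != j -> (xi K i j \o x)%VF = 0.

(** The generators of the submodules isomorphic to K_lam, and zero. *)
Definition highest_weight lam x : Prop :=
  (xi_wt K r lam \o x)%VF = x /\ strictly_killed x.

Lemma xi_eq_wt lam i j :
  (xi K i j == xi_wt K r lam) = (i == j) && (weight i == lam).
Proof.
apply/eqP/andP => [eq_xi|[/eqP<- /eqP<-]]; last by rewrite xi_wt_weight.
have := congr1 (fun x => entry x i j) eq_xi; rewrite entry_xi entry_xi_wt same_orbit_refl.
by case: eqP => [<-|_ /eqP]; [case: eqP => // _ /eqP; rewrite oner_eq0|rewrite oner_eq0].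
Qed.

Lemma entry_weight lam x h k :
  (xi_wt K r lam \o x)%VF = x -> entry x h k != 0 -> weight h = lam.
Proof.
move=> wx; apply: contraNeq => /negPf neq.
by rewrite -wx entry_xi_wtl neq mul0r.
Qed.

Lemma xi_wt_comp lam mu :
  (xi_wt K r lam \o xi_wt K r mu)%VF = if lam == mu then xi_wt K r lam else 0.
Proof.
apply: entry_inj => h k; rewrite entry_xi_wtl entry_xi_wt.
have [->|/negPf neq_hk] := eqVneq h k; last first.
  by rewrite /= mulr0; case: ifP => _; rewrite ?entry_xi_wt ?entry0 ?neq_hk.
have [eq_w|/negPf neq_w] := eqVneq (weight k) lam; last first.
  by rewrite mul0r; case: ifP => _; rewrite ?entry_xi_wt ?entry0 // neq_w andbF.
rewrite mul1r eq_w /=.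
by case: ifP => _; rewrite ?entry_xi_wt ?entry0 ?eqxx ?eq_w ?eqxx.
Qed.

Lemma xi_comp_xi_wt lam i j :
  (xi K i j \o xi_wt K r lam)%VF = if weight j == lam then xi K i j else 0.
Proof.
apply: entry_inj => h k; rewrite entry_comp (bigD1 k) //= entry_xi_wt eqxx big1 ?addr0.
  rewrite entry_xi; case: (boolP (same_orbit _ _)) => [oij|nor].
    have [_ ->] := same_orbit_weight oij.
    by rewrite mul1r; case: eqP => _; rewrite ?entry0 // entry_xi oij.
  by rewrite mul0r; case: eqP => _; rewrite ?entry0 // entry_xi (negPf nor).
by move=> l neq; rewrite entry_xi_wt (negPf neq) mulr0.
Qed.

Lemma sum_xi_wt :
  \1%VF = \sum_(lam <- undup [seq weight i | i <- enum {: I}]) xi_wt K r lam.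
Proof.
apply: entry_inj => h k; rewrite entry1 entry_sum.
rewrite (bigD1_seq (weight k)) ?undup_uniq //=; last first.
  by rewrite mem_undup map_f // mem_enum.
rewrite entry_xi_wt eqxx andbT big1 ?addr0 // => lam neq.
by rewrite entry_xi_wt [weight k == _]eq_sym (negPf neq) andbF.
Qed.

(** The weight projections sum to the identity. *)
Lemma weight_component (V : {vspace 'End(T)}) u : u \notin V ->
  exists i, (xi_wt K r (weight i) \o u)%VF \notin V.
Proof.
move=> uV; apply: contrapT => none; case/negP: uV.
rewrite -[u]comp_lfun1l sum_xi_wt.
rewrite (big_morph (fun a => (a \o u)%VF) (fun a b => comp_lfunDl a b u) (comp_lfun0l _ _)).
rewrite big_seq rpred_sum // => lam; rewrite mem_undup => /mapP[i _ ->].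
by apply/negPn/negP => ni; apply: none; exists i.
Qed.

(** For i < j the weights of i and j differ, as their heights do. So xi i j maps x
   either to zero or to a vector of a weight other than lam, which is a multiple
   of x only if it is zero. *)
Lemma stable_line_hw lam x : x != 0 -> (xi_wt K r lam \o x)%VF = x ->
  (forall i j, le_mindex i j -> (xi K i j \o x)%VF \in <[x]>%VS) ->
  highest_weight lam x.
Proof.
move=> nzx wx stable; split=> // i j le_ij neq_ij.
have /vlineP[c def_c] := stable i j le_ij; rewrite def_c.
have [-> | nzc] := eqVneq c 0; first exact: scale0r.
apply: entry_inj => h k; rewrite entry0 -def_c; apply/eqP; apply: contraTT neq_ij => nz.
have wh : weight h = lam.
  apply: (entry_weight (x := x) (k := k)) => //.
  by apply: contraNneq nz => entry_0; rewrite def_c entryZ entry_0 mulr0.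
move: nz; rewrite entry_comp => nz.
have [l nzl] : exists l, entry (xi K i j) h l * entry x l k != 0.
  apply: contrapT => none; case/eqP: nz; apply: big1 => l _.
  by apply/eqP/negPn/negP => nzl; apply: none; exists l.
have {}wl : weight l = lam.
  by apply: (entry_weight (x := x) (k := k)) => //; apply: contraNneq nzl => ->; rewrite mulr0.
have /same_orbit_weight[w_hi w_lj] : same_orbit (i, j) (h, l).
  by apply: contraNT nzl => /negPf nor; rewrite entry_xi nor mul0r.
apply/negP => neq_ij.
have := height_lt le_ij neq_ij.
by rewrite (height_weight (j := j)) ?ltnn // -w_hi -w_lj wh.
Qed.

Lemma strictly_killed_xi_wt lam x : strictly_killed x ->
  highest_weight lam (xi_wt K r lam \o x)%VF.
Proof.
move=> killed; split=> [|i j le_ij neq_ij]; first by rewrite comp_lfunA xi_wt_comp eqxx.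
by rewrite comp_lfunA xi_comp_xi_wt; case: eqP => _; rewrite ?killed ?comp_lfun0l.
Qed.

Lemma hw_xi k x i j : highest_weight (weight k) x -> le_mindex i j ->
  (xi K i j \o x)%VF = entry (xi K i j) k k *: x.
Proof.
move=> [wx killed] le_ij; have [eq_ij|neq_ij] := eqVneq i j; last first.
  rewrite killed // entry_xi; case: (boolP (same_orbit _ _)) => [/same_orbitP[s Hs]|].
    case/eqP: neq_ij; apply/ffunP => rho.
    by have [] := Hs (s^-1%g rho); rewrite permKV => <- <-.
  by rewrite scale0r.
rewrite -eq_ij entry_xi same_orbit_diag eqxx -xi_wt_weight -{1}wx comp_lfunA xi_wt_comp.
rewrite eq_sym; case: eqP => [<-|_]; first by rewrite wx scale1r.
by rewrite comp_lfun0l scale0r.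
Qed.

(** Only the xi i i matter for the action on a highest weight vector, and the entry
   of a at (k, k) is its coordinate on the one of the weight of k. *)
Lemma hw_act k x a : a \in S -> highest_weight (weight k) x ->
  (a \o x)%VF = entry a k k *: x.
Proof.
move=> aS hwx; move: a aS.
apply: (@borel_schur_ind _ _ _ (fun a => (a \o x)%VF = entry a k k *: x)) => [|i j].
  split=> [|c a b xa xb]; first by rewrite comp_lfun0l entry0 scale0r.
  by rewrite comp_lfunDl -comp_lfunZl xa xb entry_lin scalerDl scalerA.
exact: hw_xi.
Qed.

Lemma hw_line_lsubmod k x : x \in S -> highest_weight (weight k) x ->
  lsubmod S <[x]>.
Proof.
move=> xS hwx; split=> [|a _ aS /vlineP[c ->]]; first by rewrite -memvE.
by rewrite -comp_lfunZr (hw_act aS hwx) !rpredZ ?memv_line.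
Qed.

Lemma le_mindex_refl i : le_mindex i i.
Proof. by apply/forallP => rho. Qed.

Section InfiniteField.
Hypothesis infK : infinite_set [set: K]%classic.

Lemma xi_wt_in i : xi_wt K r (weight i) \in S.
Proof. by rewrite xi_wt_weight xi_in // le_mindex_refl. Qed.

(** A nonzero weight vector whose weight has minimal height is a highest weight
   vector, because xi i j with i < j lowers the height. *)
Lemma hw_exists U : lsubmod S U -> U != 0%VS ->
  exists k x, [/\ x \in U, x != 0 & highest_weight (weight k) x].
Proof.
move=> [US SU] nzU.
pose Q d := `[< exists k x, [/\ x \in U, x != 0,
                  (xi_wt K r (weight k) \o x)%VF = x & height k = d] >].
have exQ : exists d, Q d.
  have := vpick0 U; rewrite (negPf nzU) => /negbT nzu.
  have [|k nzk] := @weight_component 0%VS (vpick U); first by rewrite memv0.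
  exists (height k); apply/asboolP; exists k, (xi_wt K r (weight k) \o vpick U)%VF.
  split=> //; last by rewrite comp_lfunA xi_wt_comp eqxx.
    by apply: SU; [apply: xi_wt_in | apply: memv_pick].
  by rewrite -memv0.
case: (ex_minnP exQ) => d /asboolP[k [x [xU nzx wx dk]]] dmin.
exists k, x; split=> //; split=> // i j le_ij neq_ij.
have [wj|/negPf nj] := eqVneq (weight j) (weight k); last first.
  by rewrite -wx comp_lfunA xi_comp_xi_wt nj comp_lfun0l.
apply/eqP/negPn/negP => nz.
have : (d <= height i)%N.
  apply: dmin; apply/asboolP; exists i, (xi K i j \o x)%VF; split=> //.
    by apply: SU => //; apply: xi_in.
  apply: entry_inj => h l; rewrite entry_xi_wtl.
  case: eqP => [_|nwh]; first by rewrite mul1r.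
  rewrite mul0r entry_comp big1 // => l' _; rewrite entry_xi.
  case: (boolP (same_orbit _ _)) => [/same_orbit_weight[wh _]|]; last by rewrite mul0r.
  by case: nwh.
by rewrite leqNgt -dk -(height_weight wj) height_lt.
Qed.

Lemma simple_is_hw_line U : simple_lsubmod S U ->
  exists k x, [/\ x != 0, highest_weight (weight k) x, x \in S & U = <[x]>%VS].
Proof.
move=> [_ SU _ nzU minU]; rewrite eq_sym in nzU.
have [k [x [xU nzx hwx]]] := hw_exists SU nzU.
have xS : x \in S by case: SU => /subvP US _; apply: US.
exists k, x; split=> //.
have [|eq0|->] // := minU _ (hw_line_lsubmod xS hwx) (sub0v _).
by case/eqP: nzx; apply/eqP; rewrite -memv0 -eq0 memv_line.
Qed.

(** Simple submodules are spanned by highest weight vectors. *)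
Lemma socle_strictly_killed x : x \in socle S -> strictly_killed x.
Proof.
move: x; apply: vspan_ind; last first.
  move=> x [U /simple_is_hw_line[k [y [_ [_ killed] _ ->]]] /vlineP[c ->]] i j le_ij neq_ij.
  by rewrite -comp_lfunZr killed ?scaler0.
split=> [|c x y xK yK] i j le_ij neq_ij; first by rewrite comp_lfun0r.
by rewrite comp_lfunDr -comp_lfunZr xK ?yK // scaler0 addr0.
Qed.

Lemma hw_in_socle k x : x \in S -> highest_weight (weight k) x -> x \in socle S.
Proof.
move=> xS hwx; have [->|nzx] := eqVneq x 0; first exact: mem0v.
have simx := line_simple nzx (hw_line_lsubmod xS hwx).
exact: (subvP (simple_le_socle simx)) (memv_line x).
Qed.

Lemma functional_ex (V : {vspace 'End(T)}) y : y \notin V ->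
  exists f : 'Hom('End(T), K^o), (forall v, v \in V -> f v = 0) /\ f y = 1.
Proof.
move=> yV.
have Vy0 : (<[y]> :&: V = 0)%VS.
  apply/eqP; rewrite -subv0; apply/subvP => v; rewrite memv_cap memv0.
  case/andP=> /vlineP[c ->]; have [->|nzc] := eqVneq c 0; first by rewrite scale0r.
  by rewrite rpredZeq (negPf nzc) (negPf yV).
pose pi := daddv_pi <[y]> V.
have piV v : v \in V -> pi v = 0.
  move=> vV; have e1 : pi v + daddv_pi V <[y]> v = v.
    by apply: daddv_pi_add => //; apply: (subvP (addvSr _ _)).
  have e2 : daddv_pi V <[y]> v = v by apply: daddv_pi_id; rewrite // capvC.
  by apply: (@addIr _ v); rewrite add0r -[RHS]e1 e2.
have nzy : y != 0 by apply: contraNneq yV => ->; apply: mem0v.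
have free_y : free [tuple y] by rewrite seq1_free.
have lin : linear (coord [tuple y] 0 : 'End(T) -> K^o).
  by move=> c u v; rewrite linearP.
pose L := GRing.isLinear.Build _ _ _ _ _ lin.
pose g : {linear 'End(T) -> K^o} := HB.pack (coord [tuple y] 0 : 'End(T) -> K^o) L.
pose f : 'Hom('End(T), K^o) := linfun g.
exists (f \o pi)%VF; split=> [v vV|].
  by rewrite comp_lfunE piV // linear0.
have coord_y : coord [tuple y] 0 y = 1 := coord_free 0 0 free_y.
have pi_y : pi y = y by apply: daddv_pi_id; rewrite // memv_line.
by rewrite comp_lfunE pi_y (lfunE g).
Qed.

(** The isomorphism is a linear form that vanishes on V and takes the value 1 at
   y. *)
Lemma iso_Klam_hw (V : {vspace 'End(T)}) k y : lsubmod S V -> y \notin V ->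
  highest_weight (weight k) y -> iso_Klam (weight k) V (V + <[y]>)%VS.
Proof.
move=> [_ SV] yV hwy; have [f [fV fy]] := functional_ex yV.
have fVy v c : v \in V -> f (v + c *: y) = c.
  by move=> vV; rewrite linearD linearZ /= fV // fy add0r [_ *: _]mulr1.
exists f; split.
- exact: addvSl.
- apply/eqP; rewrite eqEsubv subvf; apply/subvP => c _.
  rewrite -(fVy 0 c (mem0v _)) add0r; apply: memv_img.
  by apply: (subvP (addvSr _ _)); rewrite rpredZ ?memv_line.
- apply/eqP; rewrite eqEsubv; apply/andP; split; apply/subvP => v.
    rewrite memv_cap memv_ker => /andP[/memv_addP[w wV [_ /vlineP[c ->] ->]]].
    by rewrite fVy // => /eqP->; rewrite scale0r addr0.
  move=> vV; rewrite memv_cap memv_ker fV // eqxx andbT.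
  exact: (subvP (addvSl _ _)).
move=> i j _ le_ij /memv_addP[v vV [_ /vlineP[c ->] ->]].
rewrite comp_lfunDr -comp_lfunZr (hw_xi hwy le_ij) scalerA !fVy //; last first.
  by apply: SV => //; apply: xi_in.
rewrite xi_eq_wt entry_xi; case: eqP => [<-|neq_ij].
  by rewrite same_orbit_diag eqxx eq_sym; case: eqP; rewrite ?mulr1 ?mulr0.
case: (boolP (same_orbit _ _)) => [/same_orbitP[s Hs]|_]; last by rewrite mulr0.
case: neq_ij; apply/ffunP => rho.
by have [] := Hs (s^-1%g rho); rewrite permKV => <- <-.
Qed.

Lemma hw_summand_of_socle k x : x != 0 -> x \in S ->
  highest_weight (weight k) x -> summand_of_socle K r (weight k).
Proof.
move=> nzx xS hwx; exists <[x]>%VS.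
  exact/simple_direct_summand/line_simple/(hw_line_lsubmod xS hwx).
rewrite -[<[x]>%VS]add0v; apply: iso_Klam_hw => //; first exact: lsubmod0.
by rewrite memv0.
Qed.

Lemma iso_Klam_is_hw lam U : Lambda r lam -> lsubmod S U -> iso_Klam lam 0%VS U ->
  exists x, [/\ x != 0, x \in U & highest_weight lam x].
Proof.
move=> /Lambda_ex[k <-] [_ SU] [f [_ fU kerf fxi]].
have /memv_imgP[x xU fx] : (1 : K^o) \in (f @: U)%VS by rewrite fU memvf.
have inj u v : u \in U -> v \in U -> f u = f v -> u = v.
  move=> uU vU eq_f; apply/eqP; rewrite -subr_eq0 -memv0 -kerf memv_cap rpredB //=.
  by rewrite memv_ker linearB /= eq_f subrr.
exists x; split=> //.
  by apply: contraTneq isT => x0; have := fx; rewrite x0 linear0 => /eqP; rewrite oner_eq0.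
split=> [|i j le_ij neq_ij].
  apply: inj => //; first by apply: SU => //; apply: xi_wt_in.
  by rewrite xi_wt_weight fxi ?le_mindex_refl // xi_eq_wt !eqxx.
apply: inj; rewrite ?mem0v //; first by apply: SU => //; apply: xi_in.
by rewrite fxi // xi_eq_wt (negPf neq_ij) linear0.
Qed.

(** The xi i j with i < j kill the socle, so a weight component of a vector of U
   outside V is a highest weight vector, and it generates U modulo V. *)
Lemma socle_quo_hw V U : simple_quo S V U -> (U <= socle S)%VS ->
  exists k y, [/\ y \in U, y \notin V, highest_weight (weight k) y
                & iso_Klam (weight k) V U].
Proof.
move=> [SV SU VU neqVU minU] Usoc.
have [u uU uV] : exists2 u, u \in U & u \notin V.
  apply/subvPn; apply: contra neqVU => UV.
  by rewrite eqEsubv VU.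
have [k nV] := weight_component uV.
set y := (_ \o u)%VF in nV.
have yU : y \in U by case: SU => _; apply=> //; apply: xi_wt_in.
have hwy : highest_weight (weight k) y.
  by apply/strictly_killed_xi_wt/socle_strictly_killed/(subvP Usoc).
have yS : y \in S by case: SU => /subvP US _; apply: US.
exists k, y; split=> //.
suff <- : (V + <[y]>)%VS = U by apply: iso_Klam_hw.
have [|||eqV|//] := minU (V + <[y]>)%VS.
- by apply: lsubmodD => //; apply: hw_line_lsubmod hwy.
- exact: addvSl.
- by rewrite subv_add VU -memvE.
by case/negP: nV; rewrite -eqV; apply: (subvP (addvSr _ _)); apply: memv_line.
Qed.

(** In a composition series of the socle, x generates the quotient at the step in
   which it first appears. *)
Lemma hw_in_multiplicity k x : x != 0 -> x \in S -> highest_weight (weight k) x ->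
  socle_multiplicity K r (weight k) != 0%N.
Proof.
move=> nzx xS hwx; apply: multiplicity_neq0; first exact: lsubmod_socle.
move=> s ser_s.
have [V [U [VU simVU xU xV]]] := comp_series_step ser_s (hw_in_socle xS hwx) nzx.
exists (V, U) => //=.
have [SV SU leVU _ minU] := simVU.
suff <- : (V + <[x]>)%VS = U by apply: iso_Klam_hw.
have [|||eqV|//] := minU (V + <[x]>)%VS.
- by apply: lsubmodD => //; apply: hw_line_lsubmod hwx.
- exact: addvSl.
- by rewrite subv_add leVU -memvE.
by case/negP: xV; rewrite -eqV; apply: (subvP (addvSr _ _)); apply: memv_line.
Qed.

End InfiniteField.
End HighestWeight.

(** * Necessary conditions on highest weights *)

Section RootSubgroups.
Variables (K : fieldType) (n r : nat).
Local Notation I := (mindex n r).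
Local Notation T := (tensor_space K n r).
Local Notation S := (borel_schur K n r).
Implicit Types (i j h k l : I) (x y : 'End(T)) (s t : 'I_n) (Y M : {set 'I_r}).
Implicit Types lam : n.-tuple nat.

Definition elem (c : K) s t : 'M[K]_n := 1%:M + c *: delta_mx s t.

Lemma elemE c s t a b : elem c s t a b = (a == b)%:R + c * ((a == s) && (b == t))%:R.
Proof. by rewrite !mxE. Qed.

Lemma elem_Borel c s t : (s < t)%N -> in_Borel (elem c s t).
Proof.
move=> lt_st; have eqF a b : (b < a)%N -> (a == s) && (b == t) = false.
  move=> lt_ba; apply/negbTE; apply: contraL lt_ba => /andP[/eqP-> /eqP->].
  by rewrite -leqNgt ltnW.
apply/in_BorelP; split=> [a b lt_ba|a]; rewrite elemE.
  by rewrite eqF // mulr0 addr0 -val_eqE gtn_eqF.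
rewrite eqxx; case: (eqVneq a s) => [->|_] /=; last by rewrite mulr0 addr0 oner_eq0.
by rewrite -val_eqE ltn_eqF //= mulr0 addr0 oner_eq0.
Qed.

Definition letter_set l s : {set 'I_r} := [set rho | l rho == s].

Lemma card_letter_set l s : #|letter_set l s| = tnth (weight l) s.
Proof. by rewrite tnth_weight cardsE. Qed.

Definition rewrite_at l Y t : I := [ffun rho => if rho \in Y then t else l rho].

Lemma rewrite_atK l Y s t : Y \subset letter_set l s -> rewrite_at (rewrite_at l Y t) Y s = l.
Proof.
move=> /fintype.subsetP Ys; apply/ffunP => rho; rewrite !ffunE.
by case: ifP => [/Ys|-> //]; rewrite inE => /eqP.
Qed.

Lemma weight_rewrite_at_eq l Y s t : s != t -> Y \subset letter_set l s ->
  tnth (weight (rewrite_at l Y t)) t = (tnth (weight l) t + #|Y|)%N.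
Proof.
move=> neq_st /fintype.subsetP Ys; rewrite -!card_letter_set -cardsUI.
rewrite [X in (_ + X)%N]eq_card0 => [|rho]; last first.
  rewrite !inE; apply/negP => /andP[/eqP lt /Ys]; rewrite inE lt => /eqP ts.
  by rewrite ts eqxx in neq_st.
rewrite addn0; apply: eq_card => rho; rewrite !inE ffunE orbC.
by case: ifP => //= _; rewrite eqxx.
Qed.

Lemma weight_rewrite_at_neq l Y s t : s != t -> Y \subset letter_set l s ->
  tnth (weight l) s = (tnth (weight (rewrite_at l Y t)) s + #|Y|)%N.
Proof.
move=> neq_st Ys; rewrite -{1}(rewrite_atK t Ys).
apply: weight_rewrite_at_eq; first by rewrite eq_sym; exact: neq_st.
by apply/fintype.subsetP => rho rhoY; rewrite inE ffunE rhoY.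
Qed.

(** A product of entries of an elementary matrix vanishes unless h arises from l by
   changing some letters s into t. *)
Lemma sum_elem c s t l (G : I -> K) : s != t ->
  \sum_(h : I) (\prod_rho elem c s t (l rho) (h rho)) * G h =
  \sum_(Y : {set 'I_r} | Y \subset letter_set l s) c ^+ #|Y| * G (rewrite_at l Y t).
Proof.
move=> neq_st; pose D (h : I) := [set rho | h rho != l rho].
pose shape (h : I) := (rewrite_at l (D h) t == h) && (D h \subset letter_set l s).
rewrite (bigID shape) /= [X in _ + X]big1 ?addr0 => [|h]; last first.
  apply: contraNeq; rewrite mulf_eq0 negb_or => /andP[/prodf_neq0 nz _].
  have eqh rho : h rho != l rho -> l rho = s /\ h rho = t.
    move=> neq; have := nz rho isT; rewrite elemE [l rho == _]eq_sym (negPf neq) add0r.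
    by case: (l rho =P s); case: (h rho =P t) => //=; rewrite mulr0 eqxx.
  apply/andP; split; last by apply/fintype.subsetP => rho; rewrite !inE => /eqh[-> _].
  apply/eqP/ffunP => rho; rewrite ffunE finset.inE.
  by case: (eqVneq (h rho) (l rho)) => [->|/eqh[_ ->]].
have DK Y : Y \subset letter_set l s -> D (rewrite_at l Y t) = Y.
  move=> /fintype.subsetP Ys; apply/setP => rho; rewrite inE ffunE.
  case: ifP => [/Ys|_]; last by rewrite eqxx.
  by rewrite inE => /eqP->; rewrite eq_sym.
rewrite (reindex_onto (fun Y => rewrite_at l Y t) D) /= => [|h /andP[/eqP->] //].
apply: eq_big => [Y|Y /andP[/andP[_ Ys] /eqP eqY]].
  apply/andP/idP => [[/andP[_ Ys] /eqP eqY]|Ys]; first by rewrite -eqY.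
  by rewrite /shape !DK // !eqxx Ys.
rewrite eqY in Ys; congr (_ * _); rewrite -prodr_const [RHS]big_mkcond.
apply: eq_bigr => rho _; rewrite elemE ffunE; case: ifP => [rhoY|_].
  have := fintype.subsetP Ys rho rhoY; rewrite inE => /eqP->.
  by rewrite (negPf neq_st) !eqxx mulr1 add0r.
by rewrite eqxx; case: eqP => [->|_] /=; rewrite ?(negPf neq_st) mulr0 addr0.
Qed.

Lemma entry_elem_comp c s t x l k : s != t ->
  entry (tensor_act r (elem c s t) \o x)%VF l k =
  \sum_(Y : {set 'I_r} | Y \subset letter_set l s) c ^+ #|Y| * entry x (rewrite_at l Y t) k.
Proof.
move=> neq_st; rewrite entry_comp -(sum_elem c l (fun h => entry x h k) neq_st).
by apply: eq_bigr => h _; rewrite entry_tensor_act.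
Qed.

Lemma elem_hw c s t k x : (s < t)%N -> highest_weight (weight k) x ->
  (tensor_act r (elem c s t) \o x)%VF = x.
Proof.
move=> lt_st hwx; rewrite (hw_act _ hwx); last exact/tensor_act_in/elem_Borel.
rewrite entry_tensor_act big1 ?scale1r // => rho _; rewrite elemE eqxx.
case: eqP => [->|_]; last by rewrite mulr0 addr0.
by rewrite -val_eqE ltn_eqF //= mulr0 addr0.
Qed.

Lemma neq0_entry x : x != 0 -> exists h k, entry x h k != 0.
Proof.
move=> nzx; apply: contrapT => none; case/eqP: nzx; apply: entry_inj => h k.
by rewrite entry0; apply/eqP/negPn/negP => nz; apply: none; exists h, k.
Qed.

(** Let u = 1 - E_st, which fixes x, and v = 1 + E_ts, so that v x = (v u) x. The
   entry of v x at (h, j), where h has the weight of k, is that of x, because any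
   change of letters t into s changes the weight. On the other hand, the column
   t of v u is zero outside the row s. Hence (v u) x vanishes at (h, j) unless h
   has a letter s wherever some word l of the same weight has a letter t. *)
Lemma hw_dominant k x s t : x != 0 -> highest_weight (weight k) x -> (s < t)%N ->
  (tnth (weight k) t <= tnth (weight k) s)%N.
Proof.
move=> /neq0_entry[h [j nz]] hwx lt_st; have [wx _] := hwx.
have neq_st : s != t by rewrite -val_eqE ltn_eqF.
have neq_ts : t != s by rewrite eq_sym.
have wh := entry_weight wx nz.
apply: contraNT nz; rewrite -ltnNge => lt_w.
pose M : 'M[K]_n := elem 1 t s *m elem (-1) s t.
have : (tensor_act r (elem 1 t s) \o x)%VF = (tensor_act r M \o x)%VF.
  by rewrite tensor_actM -comp_lfunA (elem_hw _ lt_st hwx).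
move=> /(congr1 (fun x => entry x h j)).
rewrite entry_elem_comp // (bigD1 finset.set0) ?finset.sub0set //=.
rewrite [X in _ + X]big1 => [|Y /andP[Yt nzY]].
  have -> : rewrite_at h finset.set0 s = h by apply/ffunP => rho; rewrite ffunE finset.inE.
  rewrite cards0 mul1r addr0 => ->; rewrite entry_comp big1 // => l _.
  apply/eqP; apply: contraTT lt_w; rewrite mulf_eq0 negb_or entry_tensor_act -leqNgt.
  case/andP=> /prodf_neq0 nzM /(entry_weight wx) wl.
  rewrite -{1}wl -{1}wh -!card_letter_set subset_leq_card //.
  apply/fintype.subsetP => rho; rewrite !inE => /eqP lt; have := nzM rho isT.
  rewrite lt; case: (eqVneq (h rho) s) => // neq_hs; case/eqP.
  have entryE a : M a t = elem 1 t s a t - elem 1 t s a s.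
    rewrite /M [elem (-1) s t]/elem mulmxDr mulmx1 -scalemxAr !mxE.
    rewrite mulN1r (bigD1 s) //= big1 => [|b neq]; rewrite !mxE ?eqxx ?mulr1 ?addr0 //.
    by rewrite (negPf neq) mulr0.
  by rewrite entryE !elemE eqxx (negPf neq_ts) (negPf neq_hs) andbT andbF !mul1r addr0 add0r subrr.
rewrite expr1n mul1r; apply: contraNeq nzY => /(entry_weight wx).
rewrite -wh => /(congr1 (fun w => tnth w t)); rewrite -cards_eq0.
have := weight_rewrite_at_neq neq_ts Yt => ->.
by move/eqP; rewrite -[X in X == _]addn0 eqn_add2l eq_sym.
Qed.

(** The place permutation is found by marking the places in M, respectively Y, in
   the pair (l, j). *)
Lemma rewrite_at_orbit l j Y M s t u : #|Y| = #|M| ->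
    Y \subset [set rho | (l rho == s) && (j rho == u)] ->
    M \subset [set rho | (l rho == s) && (j rho == u)] ->
  same_orbit (rewrite_at l M t, j) (rewrite_at l Y t, j).
Proof.
set R := [set rho | _] => eq_YM YR MR.
pose f (Z : {set 'I_r}) rho := (l rho, j rho, rho \in Z).
have cardT (Z : {set 'I_r}) c d : Z \subset R ->
    #|[pred rho | f Z rho == (c, d, true)]| = if (c == s) && (d == u) then #|Z| else 0%N.
  move=> /fintype.subsetP ZR; case: ifP => eq_cd.
    apply: eq_card => rho; rewrite inE /f !xpair_eqE eqb_id.
    case: (boolP (rho \in Z)) => [/ZR|]; last by rewrite andbF.
    by case/andP: eq_cd => /eqP-> /eqP->; rewrite inE => ->.
  apply: eq_card0 => rho; rewrite inE /f !xpair_eqE eqb_id.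
  apply: contraFF eq_cd => /andP[/andP[/eqP<- /eqP<-] /ZR].
  by rewrite inE.
have cardF (Z : {set 'I_r}) c d :
    #|[pred rho | f Z rho == (c, d, false)]| =
    (#|[pred rho | (l rho == c) && (j rho == d)]| - #|[pred rho | f Z rho == (c, d, true)]|)%N.
  rewrite -(cardID (mem Z) [pred rho | (l rho == c) && (j rho == d)]).
  rewrite [X in (X + _ - _)%N](_ : _ = #|[pred rho | f Z rho == (c, d, true)]|).
    rewrite addKn; apply: eq_card => rho; rewrite !inE /f !xpair_eqE eqbF_neg.
    by rewrite andbC.
  by apply: eq_card => rho; rewrite !inE /f !xpair_eqE eqb_id.
have [|sg Hs] := @perm_of_fibers _ r (f M) (f Y).
  by move=> [[c d] [|]]; rewrite ?cardF !cardT // eq_YM.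
apply/same_orbitP; exists sg => rho; have [el ej eY] := Hs rho.
by rewrite !ffunE el ej eY.
Qed.

(** Elements of the algebra with columns of weight mu form the tensor product of the
   divided powers D^mu_b (e_1, ..., e_b), and e_t occurs only in the last factor,
   where the m-th divided power of the root vector E_st multiplies monomials with
   exponents a and b of e_s and e_t by C(a + m, m). In terms of entries: let x be
   nonzero at (h, j), and change m letters t of h into s. The root subgroup fixes
   x, whose entry at the new word is zero for reasons of weight. That entry is
   also a sum over the ways to change m letters s back into t below j, which are
   C(a + m, m) in number and all contribute the entry at (h, j). *)
Lemma hw_last_binomial k x s t : x \in S -> x != 0 ->
    highest_weight (weight k) x -> (s < t)%N -> (forall b : 'I_n, b <= t)%N ->
  exists2 a, (a <= tnth (weight k) s)%N &
    forall m, (0 < m)%N -> (m <= tnth (weight k) t)%N -> 'C(a + m, m)%:R = 0 :> K.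
Proof.
move=> /borel_schur_entry[trix invx] /neq0_entry[h [j nz]] hwx lt_st max_t.
have [wx _] := hwx; have wh := entry_weight wx nz.
have neq_st : s != t by rewrite -val_eqE ltn_eqF.
have neq_ts : t != s by rewrite eq_sym.
pose Q := [set rho | (h rho == s) && (j rho == t)].
exists #|Q|.
  rewrite -wh -card_letter_set subset_leq_card //.
  by apply/fintype.subsetP => rho; rewrite !inE => /andP[].
move=> m m_gt0 le_m; rewrite -wh -card_letter_set in le_m.
have [M /andP[Mt /eqP card_M]] : exists M : {set 'I_r}, (M \subset letter_set h t) && (#|M| == m).
  have : (0 < #|[set M : {set 'I_r} | M \subset letter_set h t & #|M| == m]|)%N.
    by rewrite cards_draws bin_gt0.
  by case/card_gt0P => M; rewrite inE; exists M.
pose l := rewrite_at h M s.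
have hM : rewrite_at l M t = h := rewrite_atK s Mt.
(* The places at which l may be changed back below j. *)
pose R := [set rho | (l rho == s) && (j rho == t)].
have jM rho : rho \in M -> j rho = t.
  move=> /(fintype.subsetP Mt); rewrite inE => /eqP ht; apply/val_inj/eqP.
  by rewrite eqn_leq max_t -ht (forallP (trix _ _ nz)).
have MR : M \subset R.
  by apply/fintype.subsetP => rho rhoM; rewrite inE ffunE rhoM jM // !eqxx.
have card_R : #|R| = (#|Q| + m)%N.
  rewrite -card_M -cardsUI [X in (_ + X)%N]eq_card0 ?addn0 => [|rho].
    apply: eq_card => rho; rewrite !inE ffunE orbC.
    by case: (boolP (rho \in M)) => //= /jM->; rewrite !eqxx.
  rewrite !inE; apply/negP => /andP[/andP[/eqP hs _] /(fintype.subsetP Mt)].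
  by rewrite inE hs (negPf neq_st).
have wl : (tnth (weight k) t = tnth (weight l) t + m)%N.
  by rewrite -wh -card_M -(weight_rewrite_at_neq neq_ts Mt).
have := congr1 (fun x => entry x l j) (elem_hw 1 lt_st hwx).
rewrite entry_elem_comp // => sum_eq.
have lj0 : entry x l j = 0.
  apply/eqP/negPn/negP => /(entry_weight wx) wlk; move: wl m_gt0.
  by rewrite wlk => /eqP; rewrite -[X in X == _]addn0 eqn_add2l => /eqP <-.
move: sum_eq; rewrite lj0 (bigID (fun Y => (Y \subset R) && (#|Y| == m))) /=.
rewrite [X in _ + X]big1 ?addr0 => [|Y /andP[Ys]]; last first.
  apply: contraNeq; rewrite expr1n mul1r => nzY.
  apply/andP; split.
    apply/fintype.subsetP => rho rhoY; have := fintype.subsetP Ys rho rhoY; rewrite !inE => -> /=.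
    have := forallP (trix _ _ nzY) rho; rewrite ffunE rhoY => le_t.
    by rewrite -val_eqE eqn_leq max_t.
  have := entry_weight wx nzY => /(congr1 (fun w => tnth w t)).
  by rewrite (weight_rewrite_at_eq neq_st Ys) wl => /eqP; rewrite eqn_add2l.
rewrite (eq_bigl (mem [set Y : {set 'I_r} | Y \subset R & #|Y| == m])) => [|Y]; last first.
  rewrite !inE andbA; case: (boolP (Y \subset R)) => [YR|]; last by rewrite andbF.
  rewrite andbT (fintype.subset_trans YR) //.
  by apply/fintype.subsetP => rho; rewrite !inE => /andP[].
rewrite (eq_bigr (fun=> entry x h j)) => [|Y]; last first.
  rewrite /= inE => /andP[YR /eqP card_Y]; rewrite expr1n mul1r -hM.
  by apply: invx; apply: (@rewrite_at_orbit l j Y M s t t); rewrite ?card_Y ?card_M.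
rewrite sumr_const cards_draws card_R => /eqP.
by rewrite -(mulr_natl (entry x h j)) mulf_eq0 (negPf nz) orbF => /eqP.
Qed.


End RootSubgroups.

(** * Divisibility of binomial coefficients *)

Lemma logn_add_small (p v x m : nat) : prime p -> (p ^ v %| x)%N ->
  (0 < m)%N -> (m < p ^ v)%N -> logn p (x + m) = logn p m.
Proof.
move=> p_pr dvd_x m_gt0 lt_m.
have dvd_m : (p ^ logn p m %| m)%N by rewrite pfactor_dvdn.
have lt_v : (logn p m < v)%N.
  by rewrite -(ltn_exp2l _ _ (prime_gt1 p_pr)) (leq_ltn_trans (dvdn_leq _ dvd_m)).
have dvd_e e : (e <= v)%N -> (p ^ e %| x + m)%N = (e <= logn p m)%N.
  move=> le_e; have dvd_ex := dvdn_trans (dvdn_exp2l p le_e) dvd_x.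
  by rewrite (dvdn_addr _ dvd_ex) pfactor_dvdn.
have xm_gt0 : (0 < x + m)%N by rewrite addn_gt0 m_gt0 orbT.
apply/eqP; rewrite eqn_leq leqNgt -!pfactor_dvdn // !dvd_e //; last exact: ltnW.
by rewrite ltnn leqnn.
Qed.

(** Let p ^ v be the exact power of p that divides a + 1. By the recurrence
   (m + 1) C(a + m + 1, m + 1) = (a + 1 + m) C(a + m, m), the p-adic valuations of
   C(a + m, m) and m add up to v for 1 <= m <= p ^ v. So C(a + p ^ v, p ^ v) is
   prime to p, which forces b < p ^ v. *)
Lemma binomial_divisible_bound (p a b : nat) : prime p -> (0 < b)%N ->
    (forall m, (0 < m)%N -> (m <= b)%N -> (p %| 'C(a + m, m))%N) ->
  (p ^ (trunc_log p b).+1 <= a.+1)%N.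
Proof.
move=> p_pr b_gt0 dvd_bin; set v := logn p a.+1.
have dvd_a : (p ^ v %| a.+1)%N by rewrite pfactor_dvdn.
have [lt_v|le_v] := ltnP (trunc_log p b) v.
  by rewrite dvdn_leq // (dvdn_trans _ dvd_a) // dvdn_exp2l.
have pv_gt0 : (0 < p ^ v)%N by rewrite expn_gt0 prime_gt0.
have le_pv : (p ^ v <= b)%N.
  apply: leq_trans (trunc_logP (prime_gt1 p_pr) b_gt0).
  by rewrite leq_exp2l ?prime_gt1.
have bin_log m : (0 < m)%N -> (m <= p ^ v)%N -> (logn p 'C(a + m, m) + logn p m = v)%N.
  elim: m => // m IHm _ le_m; have [->|m_gt0] := posnP m.
    by rewrite bin1 logn1 addn0 addn1.
  have := congr1 (logn p) (mul_bin_diag (a + m.+1) m).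
  rewrite !lognM ?bin_gt0 ?addnS ?leq_addl // ?ltnS ?leq_addl // -addSn.
  rewrite (logn_add_small p_pr dvd_a m_gt0 le_m) /= => eq_log.
  by rewrite addnC -eq_log addnC IHm // ltnW.
have := dvd_bin _ pv_gt0 le_pv; have := bin_log _ pv_gt0 (leqnn _).
rewrite pfactorK // => /eqP; rewrite -[X in _ == X]add0n eqn_add2r => log0 dvd_p.
have : (0 < logn p 'C(a + p ^ v, p ^ v))%N.
  by rewrite logn_gt0 mem_primes p_pr bin_gt0 leq_addl.
by rewrite (eqP log0).
Qed.

(** This follows from m C(b + m, m) = (b + 1) C(b + m, m - 1), because p ^ e does not
   divide m. *)
Lemma dvdn_binomial (p e b m : nat) : prime p -> (p ^ e %| b.+1)%N ->
  (0 < m)%N -> (m < p ^ e)%N -> (p %| 'C(b + m, m))%N.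
Proof.
case: m => // m p_pr dvd_b _ lt_m.
have eq_bin : (m.+1 * 'C(b + m.+1, m.+1) = b.+1 * 'C(b + m.+1, m))%N.
  by rewrite mul_bin_left addnS -addSn addnK.
have : (p ^ e %| m.+1 * 'C(b + m.+1, m.+1))%N by rewrite eq_bin dvdn_mulr.
apply: contraTT => ndvd; rewrite Gauss_dvdl; last first.
  by rewrite coprimeXl // prime_coprime.
by apply: contraTN lt_m => /dvdn_leq le_m; rewrite -leqNgt le_m.
Qed.

(** * Construction of highest weight vectors *)

Section BorelGeneration.
Variables (K : fieldType) (n : nat) (G : 'M[K]_n -> Prop).
Hypothesis GM : forall g g', G g -> G g' -> G (g *m g').
Hypothesis G_diag : forall d, G (diag_mx d).
Hypothesis G_elem : forall c (s t : 'I_n), (s < t)%N -> G (elem c s t).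

Let desc (q q' : 'I_n * 'I_n) := (q'.1 <= q.1)%N.

(** When first indices decrease, the product of an off-diagonal term with a later one
   vanishes, so elementary matrices are multiplied by adding these terms. *)
Lemma elem_prod (c : 'I_n * 'I_n -> K) (qs : seq ('I_n * 'I_n)) :
    sorted desc qs -> all (fun q : 'I_n * 'I_n => q.1 < q.2)%N qs ->
  G (1%:M + \sum_(q <- qs) c q *: delta_mx q.1 q.2).
Proof.
have desc_trans : transitive desc by move=> q q' q'' le1 le2; apply: leq_trans le2 le1.
elim: qs => [|q qs IHqs] /= path_qs.
  rewrite big_nil addr0 -diag_const_mx => _; exact: G_diag.
case/andP=> lt_q lt_qs; have Gqs := IHqs (path_sorted path_qs) lt_qs.
have := GM (G_elem (c q) lt_q) Gqs; rewrite /elem mulmxDl mul1mx mulmxDr mulmx1.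
rewrite mulmx_sumr [X in _ + (_ + X)]big_seq.
rewrite [X in _ + (_ + X)]big1 ?addr0 => [|q' q'_in]; last first.
  rewrite -scalemxAl -scalemxAr mul_delta_mx_0 ?scaler0 // -val_eqE.
  have := allP (order_path_min desc_trans path_qs) q' q'_in => le_q'.
  by rewrite gtn_eqF // (leq_ltn_trans le_q').
by rewrite big_cons addrAC addrA.
Qed.

Lemma Borel_generated g : in_Borel g -> G g.
Proof.
case/in_BorelP=> tri nz.
pose c (q : 'I_n * 'I_n) := g q.1 q.2 / g q.2 q.2.
pose above (q : 'I_n * 'I_n) := (q.1 < q.2)%N.
pose qs := sort desc [seq q <- enum {: 'I_n * 'I_n} | above q].
have desc_total : total desc by move=> q q'; apply: leq_total.
have sorted_qs : sorted desc qs by apply: sort_sorted.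
have all_qs : all (fun q : 'I_n * 'I_n => q.1 < q.2)%N qs.
  by rewrite all_sort filter_all.
(* g is a unipotent matrix, with entries c q, times its diagonal part. *)
have := GM (elem_prod c sorted_qs all_qs) (G_diag (\row_s g s s)).
congr G; apply/matrixP => s t.
rewrite mul_mx_diag !mxE summxE.
rewrite (perm_big [seq q <- enum {: 'I_n * 'I_n} | above q]) ?perm_sort //=.
rewrite big_filter big_enum_cond /=.
have term (q : 'I_n * 'I_n) : (c q *: delta_mx q.1 q.2 : 'M_n) s t = (q == (s, t))%:R * c q.
  by rewrite !mxE mulrC [q]surjective_pairing xpair_eqE /= ![_ == s]eq_sym ![_ == t]eq_sym.
case: (ltngtP s t) => [lt_st|lt_ts|/val_inj eq_st].
- rewrite (bigD1 (s, t)) //= big1 ?addr0 => [|q /andP[_ neq]]; last first.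
    by rewrite term (negPf neq) mul0r.
  by rewrite term eqxx mul1r -val_eqE ltn_eqF // add0r /c /= divfK.
- rewrite big1 => [|q lt_q]; last first.
    rewrite term; case: eqP => [eq_q|_]; last by rewrite mul0r.
    by move: lt_q; rewrite eq_q /above /= ltnNge ltnW.
  by rewrite -val_eqE gtn_eqF // add0r mul0r tri.
rewrite eq_st eqxx big1 ?addr0 ?mul1r // => q lt_q.
rewrite -{1}eq_st term; case: eqP => [eq_q|_]; last by rewrite mul0r.
by move: lt_q; rewrite eq_q /above /= eq_st ltnn.
Qed.

End BorelGeneration.

Section Monomial.
Variables (K : fieldType) (n' r : nat).
Local Notation n := n'.+1.
Local Notation I := (mindex n r).
Local Notation T := (tensor_space K n r).
Local Notation S := (borel_schur K n r).
Hypothesis infK : infinite_set [set: K]%classic.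
Variables (h0 : I) (a : nat).
Hypothesis le_a : (a <= tnth (weight h0) ord0)%N.

Let lam := weight h0.
Let last_factor_exp (s : 'I_n) := if s == ord0 then a else tnth lam s.

Hypothesis bin0 : forall (s t : 'I_n) m, (s < t)%N -> (0 < m)%N ->
  (m <= tnth lam t)%N -> 'C(last_factor_exp s + m, m)%:R = 0 :> K.

(** The basis element of the algebra that corresponds to the tensor
   e_1^(lam_1 - a) (x) e_1^(a) e_2^(lam_2) ... e_n^(lam_n) of divided powers, of
   which the first factor is fixed by the Borel group up to scalars. On the last
   one, divided powers of root vectors act through the binomial coefficients that
   are supposed to vanish, so that the line spanned by the element is stable. *)
Lemma monomial_hw : exists x, [/\ x \in S, x != 0 & highest_weight lam x].
Proof.
have [P0 /andP[P0_sub /eqP card_P0]] : exists P0 : {set 'I_r},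
    (P0 \subset letter_set h0 ord0) && (#|P0| == tnth lam ord0 - a)%N.
  have : (0 < #|[set P : {set 'I_r} | P \subset letter_set h0 ord0
                                     & #|P| == tnth lam ord0 - a]|)%N.
    by rewrite cards_draws bin_gt0 card_letter_set leq_subr.
  by case/card_gt0P => P; rewrite inE; exists P.
(* The columns have letters e_1 in the first factor and e_n in the last one. *)
pose k0 : I := [ffun rho => if rho \in P0 then ord0 else ord_max].
pose first_factor_places (k : I) := [set rho | k rho != ord_max].
pose cond (h k : I) := [&& weight h == lam, weight k == weight k0 &
                       [forall rho, (k rho != ord_max) ==> (h rho == ord0)]].
pose x : 'End(T) := on_basis (fun k => \sum_(h | cond h k) ebasis K h).
have entry_x h k : entry x h k = (cond h k)%:R := entry_on_basis _ cond h k.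
have xS : x \in S.
  apply/(borel_schurP infK); split=> [h k|i j h k oij]; rewrite !entry_x.
    case: (boolP (cond h k)) => [/and3P[_ _ /forallP fix_hk] _|_]; last by rewrite eqxx.
    apply/forallP => rho; have := fix_hk rho.
    by case: eqP => [->|_ /= /eqP-> //]; rewrite -ltnS ltn_ord.
  congr (_%:R); have [wh wk] := same_orbit_weight oij; rewrite /cond wh wk.
  congr (nat_of_bool [&& _, _ & _]); have [s Hs] := same_orbitP _ _ _ _ oij.
  apply/forallP/forallP => fix_hk rho.
    by have := fix_hk (s^-1%g rho); have [-> ->] := Hs (s^-1%g rho); rewrite permKV.
  by have [-> ->] := Hs rho; apply: fix_hk.
have nzx : x != 0.
  apply/eqP => x0; have := entry_x h0 k0; rewrite x0 entry0 /cond !eqxx /=.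
  suff -> : [forall rho, (k0 rho != ord_max) ==> (h0 rho == ord0)].
    by move/eqP; rewrite eq_sym oner_eq0.
  apply/forallP => rho; rewrite ffunE.
  by case: ifP => [/(fintype.subsetP P0_sub)|_]; rewrite ?eqxx // inE => ->; rewrite implybT.
have wx : (xi_wt K r lam \o x)%VF = x.
  apply: entry_inj => h k; rewrite entry_xi_wtl entry_x /cond.
  by case: eqP => _; rewrite ?mul1r ?mul0r.
have card_fixed h k : cond h k -> ord0 != ord_max :> 'I_n ->
    #|first_factor_places k| = (tnth lam ord0 - a)%N.
  case/and3P=> _ /eqP wk _ neq0.
  have cardC k1 : #|first_factor_places k1| = (r - tnth (weight k1) ord_max)%N.
    have -> : first_factor_places k1 = ~: letter_set k1 ord_max.
      by apply/setP => rho; rewrite !inE.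
    have := cardsC (letter_set k1 ord_max); rewrite card_letter_set card_ord => eq_r.
    by rewrite -[LHS](addKn (tnth (weight k1) ord_max)) eq_r.
  rewrite cardC wk -cardC -card_P0; apply: eq_card => rho; rewrite inE ffunE.
  by case: ifP; rewrite ?neq0 ?eqxx.
have elem_x c (s t : 'I_n) : (s < t)%N -> (tensor_act r (elem c s t) \o x)%VF = x.
  move=> lt_st; have neq_st : s != t by rewrite -val_eqE ltn_eqF.
  have neq_t0 : t != ord0 by rewrite -val_eqE -lt0n (leq_ltn_trans _ lt_st).
  have neq_0max : ord0 != ord_max :> 'I_n.
    rewrite -val_eqE /= eq_sym -lt0n -ltnS; apply: leq_trans (ltn_ord t).
    by rewrite ltnS (leq_ltn_trans _ lt_st).
  apply: entry_inj => l k; rewrite entry_elem_comp //.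
  have [wl|/eqP nwl] := eqVneq (weight l) lam.
    rewrite (bigD1 finset.set0) ?finset.sub0set //= [X in _ + X]big1 => [|Y /andP[Ys nzY]].
      have -> : rewrite_at l finset.set0 t = l by apply/ffunP => rho; rewrite ffunE finset.inE.
      by rewrite cards0 mul1r addr0.
    apply: contraNeq nzY; rewrite mulf_eq0 negb_or => /andP[_ /(entry_weight wx)].
    rewrite -wl => /(congr1 (fun w => tnth w t)); rewrite (weight_rewrite_at_eq neq_st Ys).
    by move/eqP; rewrite -[X in _ == X]addn0 eqn_add2l cards_eq0.
  have -> : entry x l k = 0.
    by apply/eqP/negPn/negP => /(entry_weight wx).
  (* If some change of letters reaches the weight lam, then those which do are the
     changes at any #|Y0| places of R. *)
  have [[Y0 [Y0s cond0]]|none] := pselect (exists Y0 : {set 'I_r},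
      Y0 \subset letter_set l s /\ cond (rewrite_at l Y0 t) k); last first.
    rewrite big1 // => Y Ys; rewrite entry_x; case: (boolP (cond _ _)) => [condY|_].
      by case: none; exists Y.
    by rewrite mulr0.
  have [/eqP wY0 wk /forallP fixY0] := and3P cond0.
  pose R := [set rho | (l rho == s) && (k rho == ord_max)].
  have l_fixed rho : k rho != ord_max -> rho \notin Y0 /\ l rho = ord0.
    move=> nk; have := fixY0 rho; rewrite nk ffunE /=.
    by case: ifP => _ /eqP; [move/eqP: neq_t0|].
  have wt_t : tnth lam t = (tnth (weight l) t + #|Y0|)%N.
    by rewrite -wY0 (weight_rewrite_at_eq neq_st Y0s).
  have wt_s : tnth (weight l) s = (tnth lam s + #|Y0|)%N.
    by rewrite -wY0 (weight_rewrite_at_neq neq_st Y0s).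
  have Y0_gt0 : (0 < #|Y0|)%N.
    rewrite lt0n cards_eq0; apply/eqP => Y00; case: nwl.
    by rewrite -wY0 Y00; congr weight; apply/ffunP => rho; rewrite ffunE finset.inE.
  have card_R : #|R| = (last_factor_exp s + #|Y0|)%N.
    rewrite /last_factor_exp; case: (eqVneq s ord0) => [s0|nz_s].
      have := cardsID (first_factor_places k) (letter_set l ord0).
      rewrite (finset.setIidPr _); last first.
        by apply/fintype.subsetP => rho; rewrite !inE => /l_fixed[_ ->].
      rewrite (card_fixed _ _ cond0 neq_0max) card_letter_set -s0 wt_s s0 => eq_card.
      have -> : #|R| = #|letter_set l ord0 :\: first_factor_places k|.
        by apply: fintype.eq_card => rho; rewrite !inE negbK s0 andbC.
      by apply/eqP; rewrite -(eqn_add2l (tnth lam ord0 - a)) eq_card addnA subnK.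
    rewrite /= -wt_s -card_letter_set; apply: eq_card => rho; rewrite !inE.
    case: eqP => //= ls; apply/eqP; apply: contraNeq nz_s => /l_fixed[_ <-].
    by rewrite ls.
  rewrite (eq_bigr (fun Y : {set _} =>
      c ^+ #|Y0| * ((Y \subset R) && (#|Y| == #|Y0|))%:R)); last first.
    move=> Y Ys; rewrite entry_x; have [condY|ncondY] := boolP (cond _ _).
      have card_Y : #|Y| = #|Y0|.
        have [/eqP wY _ _] := and3P condY; apply/eqP.
        by rewrite -(eqn_add2l (tnth (weight l) t)) -wt_t -(weight_rewrite_at_eq neq_st Ys) wY.
      rewrite card_Y eqxx andbT; suff -> : Y \subset R by [].
      apply/fintype.subsetP => rho rhoY; have := fintype.subsetP Ys rho rhoY.
      rewrite !inE => -> /=; have [_ _ /forallP/(_ rho)] := and3P condY.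
      by rewrite ffunE rhoY (negPf neq_t0) implybF negbK.
    rewrite mulr0; case: (boolP (_ && _)) => [/andP[YR /eqP card_Y]|_]; last by rewrite mulr0.
    case/negP: ncondY; apply/and3P; split=> //.
      rewrite -wY0; apply/eqP.
      have /same_orbit_weight[-> _] // : same_orbit (rewrite_at l Y0 t, l) (rewrite_at l Y t, l).
      by apply: (@rewrite_at_orbit _ _ l l Y Y0 s t s) => //; apply/fintype.subsetP => rho;
         [move/(fintype.subsetP Ys)|move/(fintype.subsetP Y0s)]; rewrite !inE => ->.
    apply/forallP => rho; apply/implyP => nk; have [_ l0] := l_fixed rho nk.
    rewrite ffunE l0; case: ifP => // /(fintype.subsetP YR); rewrite inE => /andP[_ /eqP kmax].
    by rewrite kmax eqxx in nk.
  transitivity (\sum_(Y in [set Y : {set 'I_r} | Y \subset R & #|Y| == #|Y0|]) c ^+ #|Y0|).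
    rewrite [LHS]big_mkcond [RHS]big_mkcond; apply: eq_bigr => Y _; rewrite inE.
    case: (boolP (_ && _)) => [/andP[YR _]|_]; last by rewrite mulr0; case: ifP.
    rewrite mulr1 (fintype.subset_trans YR) //.
    by apply/fintype.subsetP => rho; rewrite !inE => /andP[].
  rewrite sumr_const cards_draws card_R -(mulr_natl (c ^+ #|Y0|)).
  by rewrite (bin0 lt_st) ?mul0r // wt_t leq_addl.
have diag_x d : exists c, (tensor_act r (diag_mx d) \o x)%VF = c *: x.
  exists (\prod_rho d 0 (h0 rho)); apply: entry_inj => h k; rewrite entryZ entry_comp.
  rewrite (bigD1 h) //= big1 ?addr0 => [|l neq]; last first.
    have [rho neq_rho] : exists rho, h rho != l rho.
      apply/existsP; apply: contraNT neq; rewrite negb_exists => /forallP eq_hl.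
      by apply/eqP/ffunP => rho; apply/esym/eqP/negPn/eq_hl.
    by rewrite entry_tensor_act (bigD1 rho) //= mxE (negPf neq_rho) !mul0r.
  have [->|nz] := eqVneq (entry x h k) 0; first by rewrite !mulr0.
  congr (_ * _); have [s Hs] := weight_eqP (esym (entry_weight wx nz)).
  rewrite entry_tensor_act [RHS](reindex_inj (@perm_inj _ s)).
  by apply: eq_bigr => rho _; rewrite mxE eqxx Hs.
have borel_x g : in_Borel g -> exists c, (tensor_act r g \o x)%VF = c *: x.
  apply: (Borel_generated (G := fun g => exists c, (tensor_act r g \o x)%VF = c *: x)).
  - move=> g1 g2 [c1 e1] [c2 e2]; exists (c2 * c1).
    by rewrite tensor_actM -comp_lfunA e2 -comp_lfunZr e1 scalerA.
  - exact: diag_x.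
  by move=> c s t lt_st; exists 1; rewrite scale1r elem_x.
have stable y : y \in S -> (y \o x)%VF \in <[x]>%VS.
  move: y; apply: (@vspan_ind _ _ _ (fun y => (y \o x)%VF \in <[x]>%VS)) => [|_ [g Bg <-]].
    split=> [|c u v ux vx]; first by rewrite comp_lfun0l mem0v.
    by rewrite comp_lfunDl -comp_lfunZl rpredD ?rpredZ.
  by have [c ->] := borel_x g Bg; rewrite rpredZ ?memv_line.
exists x; split=> //; apply: stable_line_hw => // i j le_ij.
by apply: stable; apply: xi_in.
Qed.

End Monomial.

(** * The socle in terms of parts of the weight *)

Lemma part_tnth (n : nat) (lam : n.-tuple nat) (s : 'I_n) : part lam s.+1 = tnth lam s.
Proof. by rewrite /part (tnth_nth 0%N). Qed.

Lemma pchar_binomial0 (K : fieldType) (p e b m : nat) : p \in [pchar K] ->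
  (p ^ e %| b.+1)%N -> (0 < m)%N -> (m < p ^ e)%N -> 'C(b + m, m)%:R = 0 :> K.
Proof.
move=> pK dvd_b m_gt0 lt_m; apply/eqP; rewrite -(dvdn_pcharf pK).
exact: dvdn_binomial (pcharf_prime pK) dvd_b m_gt0 lt_m.
Qed.

Definition top_word (n r : nat) : mindex n.+1 r := [ffun => ord0].

Section Consequences.
Variables (K : fieldType) (r : nat).
Local Notation S n := (borel_schur K n r).

Lemma hw_partition n (k : mindex n r) (x : 'End(tensor_space K n r)) :
  x != 0 -> highest_weight (weight k) x -> is_partition (weight k).
Proof.
move=> nzx hwx; apply/(sortedP 0%N) => i; rewrite size_tuple => lt_i.
have := hw_dominant (s := Ordinal (ltnW lt_i)) (t := Ordinal lt_i) nzx hwx (ltnSn i).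
by rewrite !(tnth_nth 0%N).
Qed.

Lemma hw_last_pchar0 n (k : mindex n.+2 r) (x : 'End(tensor_space K n.+2 r)) :
    [pchar K] =i pred0 -> x \in S n.+2 -> x != 0 -> highest_weight (weight k) x ->
  part (weight k) n.+2 = 0%N.
Proof.
move=> /pcharf0P char0 xS nzx hwx.
have [||a _ bin0] := hw_last_binomial (s := inord n) (t := ord_max) xS nzx hwx.
- by rewrite /= inordK.
- by move=> b; rewrite -ltnS ltn_ord.
rewrite (part_tnth _ ord_max); have [//|nz] := posnP (tnth (weight k) ord_max).
have := bin0 _ nz (leqnn _) => /eqP; rewrite char0 => /eqP bin_eq0.
by have := leq_addl a (tnth (weight k) ord_max); rewrite -bin_gt0 bin_eq0.
Qed.

Lemma hw_last_pchar n p (k : mindex n.+2 r) (x : 'End(tensor_space K n.+2 r)) :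
    p \in [pchar K] -> x \in S n.+2 -> x != 0 -> highest_weight (weight k) x ->
  part (weight k) n.+2 = 0%N \/
  (p ^ (trunc_log p (part (weight k) n.+2)).+1 - 1 <= part (weight k) n.+1)%N.
Proof.
move=> pK xS nzx hwx.
have [||a le_a bin0] := hw_last_binomial (s := inord n) (t := ord_max) xS nzx hwx.
- by rewrite /= inordK.
- by move=> b; rewrite -ltnS ltn_ord.
have part_s : part (weight k) n.+1 = tnth (weight k) (inord n).
  by rewrite -part_tnth inordK.
rewrite (part_tnth _ ord_max) part_s.
have [->|nz] := posnP (tnth (weight k) ord_max); [by left|right].
apply: leq_trans le_a; rewrite leq_subLR add1n.
apply: binomial_divisible_bound (pcharf_prime pK) nz _ => m m_gt0 le_m.
by rewrite (dvdn_pcharf pK) bin0.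
Qed.

Hypothesis infK : infinite_set [set: K]%classic.

Lemma socle_factor_hw n V U : comp_factor (S n) (socle (S n)) V U ->
  exists (k : mindex n r) x, [/\ x \in S n, x != 0, highest_weight (weight k) x
                & iso_Klam (weight k) V U].
Proof.
case/comp_factor_simple=> simVU Usoc.
have [k [y [yU yV hwy isoVU]]] := socle_quo_hw infK simVU Usoc.
exists k, y; split=> //.
  by have [_ [/vector.subvP US _] _ _ _] := simVU; apply: US.
by apply: contraNneq yV => ->; apply: mem0v.
Qed.

Lemma top_weightE n : weight (top_word n r) = top_weight n.+1 r .
Proof.
apply: eq_from_tnth => s; rewrite tnth_weight tnth_mktuple.
rewrite -[s == 0%N :> nat]/(s == ord0); case: eqP => [->|/eqP neq].
  by rewrite -[RHS]card_ord; apply: eq_card => rho; rewrite inE ffunE eqxx.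
by apply: eq_card0 => rho; rewrite inE ffunE eq_sym (negPf neq).
Qed.

(** With an empty last factor, the monomial is the idempotent of the top weight. *)
Lemma top_weight_hw n : exists x, [/\ x \in S n.+1, x != 0 &
  highest_weight (weight (top_word n r)) x].
Proof.
apply: (monomial_hw infK (leq0n _)) => s t m lt_st m_gt0.
rewrite top_weightE tnth_mktuple; case: eqP => [t0|_].
  by rewrite t0 in lt_st.
by rewrite leqNgt m_gt0.
Qed.

Lemma weight_top2 (lam : 2.-tuple nat) : Lambda r lam -> part lam 2 = 0%N ->
  lam = top_weight 2 r.
Proof.
rewrite /Lambda sumn_tuple !big_ord_recl big_ord0 addn0 (part_tnth _ ord_max).
rewrite (_ : lift ord0 ord0 = ord_max :> 'I_2); last exact: val_inj.
move=> sum_lam lam2; rewrite lam2 addn0 in sum_lam.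
apply: eq_from_tnth => s; rewrite tnth_mktuple.
case: (unliftP ord0 s) => [s' ->|->]; last exact/eqP.
by rewrite [s']ord1 (_ : lift ord0 0 = ord_max) //; apply: val_inj.
Qed.

(** Weight components of vectors of the socle are highest weight vectors, so their
   weights have second part zero: only (r, 0) occurs. *)
Lemma socle_pchar0_2 x : [pchar K] =i pred0 -> x \in socle (S 2) ->
  highest_weight (weight (top_word 1 r)) x.
Proof.
move=> char0 xsoc; set top := weight _.
have [soc_le soc_stable] := lsubmod_socle (S 2).
have topx : (xi_wt K r top \o x)%VF \in socle (S 2).
  by apply: soc_stable => //; apply: xi_wt_in.
split; last exact: socle_strictly_killed xsoc.
apply/eqP; rewrite eq_sym -subr_eq0; apply/negPn/negP => nz.
set d := _ - _ in nz; have dsoc : d \in socle (S 2) by apply: rpredB.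
have [|k nzk] := @weight_component _ _ _ 0%VS d; first by rewrite memv0.
rewrite memv0 in nzk.
have hwk := strictly_killed_xi_wt (weight k) (socle_strictly_killed infK dsoc).
have kS : (xi_wt K r (weight k) \o d)%VF \in S 2.
  by apply: (vector.subvP soc_le); apply: soc_stable => //; apply: xi_wt_in.
have k_top : weight k = top.
  rewrite /top top_weightE.
  by apply: weight_top2 (Lambda_weight k) (hw_last_pchar0 char0 kS nzk hwk).
by case/eqP: nzk; rewrite k_top /d comp_lfunDr comp_lfunNr comp_lfunA xi_wt_comp eqxx subrr.
Qed.

(** Every vector of the socle generates a copy of the same simple module, so any basis
   provides a decomposition. *)
Lemma socle_pchar0_2_sum : [pchar K] =i pred0 ->
  exists (m : nat) (U : 'I_m -> {vspace 'End(tensor_space K 2 r)}),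
      [/\ (0 < m)%N,
          forall k, lsubmod (S 2) (U k) /\ iso_Klam (top_weight 2 r) 0%VS (U k),
          (\sum_(k < m) U k)%VS = socle (S 2) & directv (\sum_(k < m) U k)].
Proof.
move=> char0; set soc := socle (S 2).
have [soc_le _] := lsubmod_socle (S 2).
pose b k := (vbasis soc)`_k; have b_soc k : (k < \dim soc)%N -> b k \in soc.
  by move=> lt_k; apply: vbasis_mem; rewrite mem_nth ?size_tuple.
have nzb (k : 'I_(\dim soc)) : b k != 0.
  by apply: (basis_not0 (vbasisP soc)); rewrite mem_nth ?size_tuple.
have sum_b : (\sum_(k < \dim soc) <[b k]>)%VS = soc.
  rewrite -[RHS](span_basis (vbasisP soc)) span_def (big_nth 0) big_mkord size_tuple.
  by [].
exists (\dim soc), (fun k => <[b k]>%VS); split=> //.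
- have [x [xS nzx hwx]] := top_weight_hw 1.
  rewrite lt0n dimv_eq0; apply: contraNneq nzx => soc0.
  by rewrite -memv0 -soc0; apply: hw_in_socle hwx.
- move=> k; have hwb := socle_pchar0_2 char0 (b_soc k (ltn_ord k)).
  have bS : b k \in S 2 by apply: (vector.subvP soc_le); apply: b_soc.
  split; first exact: hw_line_lsubmod hwb.
  rewrite -top_weightE -[<[b k]>%VS]add0v; apply: iso_Klam_hw => //.
    exact: lsubmod0.
  by rewrite memv0.
rewrite directvE /= sum_b; apply/eqP; rewrite -[LHS]card_ord -sum1_card.
by apply: eq_bigr => k _; rewrite dim_vline nzb.
Qed.

Lemma summand_iff2 p (lam : 2.-tuple nat) : p \in [pchar K] -> Lambda r lam ->
  summand_of_socle K r lam <->
  (lam = top_weight 2 r \/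
   [/\ is_partition lam, part lam 2 != 0%N &
       (p ^ (trunc_log p (part lam 2)).+1 - 1 <= part lam 1)%N]).
Proof.
move=> pK Llam; have p_pr := pcharf_prime pK.
split=> [[U [US _] isoU]|[->|[_ nz le_q]]].
- have [x [nzx xU hwx]] := iso_Klam_is_hw infK Llam US isoU.
  have xS : x \in S 2 by case: US => /vector.subvP + _; apply.
  have [k k_lam] := Lambda_ex Llam; rewrite -k_lam in hwx *.
  have [lam2|le_q] := hw_last_pchar pK xS nzx hwx.
    by left; apply: weight_top2; rewrite ?Lambda_weight.
  have [lam2|nz] := eqVneq (part (weight k) 2) 0%N.
    by left; apply: weight_top2; rewrite ?Lambda_weight.
  by right; split=> //; apply: hw_partition hwx.
- have [x [xS nzx hwx]] := top_weight_hw 1.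
  by rewrite -top_weightE; apply: hw_summand_of_socle hwx.
have [k k_lam] := Lambda_ex Llam; subst lam.
set q := (p ^ _)%N in le_q; have q_gt0 : (0 < q)%N by rewrite expn_gt0 prime_gt0.
have le_a : (q - 1 <= tnth (weight k) ord0)%N by rewrite -part_tnth.
have [x [xS nzx hwx]] : exists x, [/\ x \in S 2, x != 0 & highest_weight (weight k) x].
  apply: (monomial_hw infK le_a) => s t m lt_st m_gt0 le_m.
  have t1 : t = ord_max.
    apply/val_inj/eqP; rewrite /=.
    by rewrite eqn_leq -ltnS ltn_ord (leq_ltn_trans _ lt_st).
  have -> : s = ord0.
    by apply/val_inj/eqP; rewrite -leqn0 -ltnS; move: lt_st; rewrite t1.
  rewrite eqxx; apply: (pchar_binomial0 (e := (trunc_log p (part (weight k) 2)).+1) pK) => //.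
    by rewrite -/q subn1 prednK.
  rewrite -/q; apply: leq_ltn_trans le_m _; rewrite t1 -part_tnth.
  exact: trunc_log_ltn (prime_gt1 p_pr).
exact: hw_summand_of_socle hwx.
Qed.

(** With q = p ^ (L + 1), the exponents of e_1 and e_2 in the last factor are pq - 1
   and 2q - 1. The first is -1 modulo pq, which exceeds lam_2 = 2q - 1 and lam_3,
   and the second is -1 modulo q, which exceeds lam_3. *)
Lemma multiplicity3 p (lam : 3.-tuple nat) : p \in [pchar K] ->
    Lambda r lam -> part lam 3 != 0%N ->
    (p ^ (trunc_log p (part lam 3)).+2 - 1 <= part lam 1)%N ->
    part lam 2 = (2 * p ^ (trunc_log p (part lam 3)).+1 - 1)%N ->
  socle_multiplicity K r lam != 0%N.
Proof.
move=> pK Llam nz; have p_pr := pcharf_prime pK.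
have [k k_lam] := Lambda_ex Llam; subst lam; set L := trunc_log _ _ => le_1 eq_2.
have q_gt0 e : (0 < p ^ e)%N by rewrite expn_gt0 prime_gt0.
have le_a : (p ^ L.+2 - 1 <= tnth (weight k) ord0)%N by rewrite -part_tnth.
have lt_3 : (part (weight k) 3 < p ^ L.+1)%N := trunc_log_ltn _ (prime_gt1 p_pr).
have le_q : (2 * p ^ L.+1 <= p ^ L.+2)%N by rewrite [X in (_ <= X)%N]expnS leq_mul // prime_gt1.
have parts (t : 'I_3) : (0 < t)%N -> (tnth (weight k) t < p ^ L.+2)%N.
  rewrite -part_tnth; case: t => [[|[|[|t]]] lt_t] //= _.
    by rewrite eq_2 subn1 prednK ?muln_gt0 ?q_gt0.
  by apply: leq_trans lt_3 _; rewrite leq_exp2l // prime_gt1.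
have [x [xS nzx hwx]] : exists x, [/\ x \in S 3, x != 0 & highest_weight (weight k) x].
  apply: (monomial_hw infK le_a) => s t m lt_st m_gt0 le_m.
  case: eqP => [_|/eqP nz_s].
    apply: (pchar_binomial0 (e := L.+2) pK) => //; first by rewrite subn1 prednK.
    by apply: leq_ltn_trans le_m (parts t _); apply: leq_ltn_trans lt_st.
  have [s1 t2] : s = 1%N :> nat /\ t = 2%N :> nat.
    by case: s t lt_st nz_s {le_m} => [[|[|[|s]]] lt_s] [[|[|[|t]]] lt_t].
  apply: (pchar_binomial0 (e := L.+1) pK) => //.
    by rewrite -part_tnth s1 eq_2 subn1 prednK ?muln_gt0 ?q_gt0 // dvdn_mull.
  by apply: leq_ltn_trans le_m _; rewrite -part_tnth t2.
exact: hw_in_multiplicity hwx.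
Qed.

End Consequences.

Theorem theorem7p3 (K : fieldType) (n r : nat)
    (K_infinite : infinite_set [set: K]%classic)
    (n_gt0 : (0 < n)%N) (r_gt0 : (0 < r)%N) :
  let S := borel_schur K n r in
  let soc := socle S in
  (* (1) *)
  summand_of_socle K r (top_weight n r) /\
  (* (2) *)
  ([pchar K] =i pred0 -> n = 2%N ->
    exists (m : nat) (U : 'I_m -> {vspace 'End(tensor_space K n r)}),
      [/\ (0 < m)%N,
          forall k, lsubmod S (U k) /\ iso_Klam (top_weight n r) 0%VS (U k),
          (\sum_(k < m) U k)%VS = soc & directv (\sum_(k < m) U k)]) /\
  (* (3) *)
  (forall p : nat, p \in [pchar K] -> n = 2%N ->
    forall lam : n.-tuple nat, Lambda r lam ->
      summand_of_socle K r lam <->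
      (lam = top_weight n r \/
       [/\ is_partition lam, part lam 2 != 0%N &
           (p ^ (trunc_log p (part lam 2)).+1 - 1 <= part lam 1)%N])) /\
  (* (4) *)
  ([pchar K] =i pred0 -> (3 <= n)%N ->
    forall V U, comp_factor S soc V U ->
      exists lam : n.-tuple nat,
        [/\ Lambda r lam, iso_Klam lam V U, is_partition lam
          & part lam n = 0%N]) /\
  (* (5) *)
  (forall p : nat, p \in [pchar K] -> (3 <= n)%N ->
    forall V U, comp_factor S soc V U ->
      exists lam : n.-tuple nat,
        [/\ Lambda r lam, iso_Klam lam V U, is_partition lam
          & part lam n = 0%N \/
            (p ^ (trunc_log p (part lam n)).+1 - 1 <= part lam n.-1)%N]) /\
  (* (6) *)
  (forall p : nat, p \in [pchar K] -> (3 <= p)%N -> n = 3%N ->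
    forall lam : n.-tuple nat, Lambda r lam -> part lam 3 != 0%N ->
      (p ^ (trunc_log p (part lam 3)).+2 - 1 <= part lam 1)%N ->
      part lam 2 = (2 * p ^ (trunc_log p (part lam 3)).+1 - 1)%N ->
      socle_multiplicity K r lam != 0%N).
Proof.
case: n n_gt0 => // n _; split; [|split; [|split; [|split; [|split]]]].
- have [x [xS nzx hwx]] := top_weight_hw r K_infinite n.
  by rewrite -top_weightE; apply: hw_summand_of_socle hwx.
- by move=> char0 [n1]; subst n; apply: socle_pchar0_2_sum.
- by move=> p pK [n1] lam Llam; subst n; apply: summand_iff2.
- case: n => // n char0 _ V U /(socle_factor_hw K_infinite)[k [x [xS nzx hwx isoVU]]].
  exists (weight k); split=> //; first exact: Lambda_weight.
    exact: hw_partition hwx.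
  exact: hw_last_pchar0 hwx.
- case: n => // n p pK _ V U /(socle_factor_hw K_infinite)[k [x [xS nzx hwx isoVU]]].
  exists (weight k); split=> //; first exact: Lambda_weight.
    exact: hw_partition hwx.
  exact: hw_last_pchar hwx.
by move=> p pK _ [n2] lam; subst n; apply: multiplicity3.
Qed.
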